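(* Let $\Gamma$ be a group. Suppose given two comparable actions of $\Gamma$ on nontrivial roughly geodesically complete Gromov hyperbolic spaces $(X,d)$ and $(Y,d')$, both of which are geometrically dense. If $\ell_d=\ell_{d'}:\Gamma\to\mathbb{R}^{\ge0}$, then there exists a $\Gamma$-equivariant rough isometry $\phi:X\to Y$, i.e. there exists a constant $C>0$ such that for all $p,q\in X$, $$|d'(\phi(p),\phi(q))-d(p,q)|<C.$$
   Context: For a metric space $(X,d)$ and $o\in X$, the Gromov product is $\langle p,q\rangle_o=\frac12(d(p,o)+d(q,o)-d(p,q))$. $(X,d)$ is $\delta$-Gromov hyperbolic if $\langle p,q\rangle_o\ge\min\{\langle p,r\rangle_o,\langle r,q\rangle_o\}-\delta$ for all $o,p,q,r\in X$, and Gromov hyperbolic if this holds for some $\delta>0$. The Gromov boundary $\partial X$ is the set of equivalence classes of sequences $(x_n)$ in $X$ with $\langle x_i,x_j\rangle_o\to\infty$, where $(x_n)\sim(y_n)$ if $\langle x_i,y_j\rangle_o\to\infty$; it carries its usual topology. $X$ is nontrivial if $\partial X$ contains at least 3 points. A map $\phi:(X,d)\to(Y,d')$ is a $C$-roughly isometric embedding if $|d'(\phi(p),\phi(q))-d(p,q)|\le C$ for all $p,q$, and a $C$-rough isometry if moreover its image is cobounded (there is $L$ such that every point of $Y$ is within distance $L$ of $\phi(X)$). A $K$-rough geodesic is a $K$-roughly isometric embedding of an interval; a space is $K$-roughly geodesic if any two points are joined by a $K$-rough geodesic. $(X,d)$ is roughly geodesically complete if there exist $K,\delta>0$ such that: (i)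 $(X,d)$ is $K$-roughly geodesic and $\delta$-Gromov hyperbolic; (ii) it is $K$-visual: for every $p\in X$ and $x\in\partial X$ there is a $K$-rough geodesic path starting from $p$ and converging to $x$; (iii) it is $K$-roughly complete: for any $p,q\in X$ there is an infinite $K$-rough geodesic path passing through $p$, $q$ and converging to some $x\in\partial X$. All actions are by isometries. The limit set $\Lambda_X\Gamma$ is $\overline{\Gamma\cdot o}\cap\partial X$ (independent of $o$). A hyperbolic element is one with positive translation length; it has exactly two fixed points in $\partial X$. An action is non-elementary if $\Gamma$ contains two hyperbolic elements with disjoint pairs of fixed points in $\partial X$, and quasi-parabolic if $\Gamma$ contains hyperbolic elements and has exactly one global fixed point in $\partial X$, with limit set having more than two points. The action on $X$ is geometrically dense if it is non-elementary or quasi-parabolic and $\Lambda_X\Gamma=\partial X$. Two actions on $X$ and $Y$ are comparable if there is a $\Gamma$-equivariant homeomorphism $\Lambda_X\Gamma\to\Lambda_Y\Gamma$. The translation length is $\ell_d(\gamma)=\lim_{n\to\infty}\frac{d(\gamma^n o,o)}{n}$.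
   Formalization: ''Γ-equivariant'' is taken up to a uniformly bounded error, d'(φ(gp), gφ(p)) ≤ B for all g and p; exact equivariance can fail, e.g. when a finite normal subgroup acts trivially on X but freely on Y. *)

(* Defs.v *)
From HB Require Import structures.
From mathcomp Require Import all_boot all_order all_algebra.
From mathcomp Require Import all_classical all_reals all_analysis.

Set Implicit Arguments.
Unset Strict Implicit.
Unset Printing Implicit Defensive.

Import Order.TTheory GRing.Theory Num.Theory.
Import numFieldNormedType.Exports.

Local Open Scope classical_set_scope.
Local Open Scope card_scope.
Local Open Scope ring_scope.

Definition gromov_product {R : realType} {X : metricType R} (o p q : X) : R :=
  (mdist p o + mdist q o - mdist p q) / 2.

Definition gromov_hyperbolic {R : realType} (X : metricType R) (delta : R) :=
  forall o p q r : X,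
    Num.min (gromov_product o p r) (gromov_product o r q) - delta
    <= gromov_product o p q.

(* <x_i, y_j>_o tends to infinity as i and j do. Changing o alters Gromov
   products by a bounded amount, so "forall o" and "for one o" agree. *)
Definition asymptotic {R : realType} {X : metricType R} (x y : nat -> X) :=
  forall o : X,
    gromov_product o (x ij.1) (y ij.2) @[ij --> (\oo, \oo)] --> +oo.

Definition gromov_seq {R : realType} {X : metricType R} (x : nat -> X) :=
  asymptotic x x.

Definition boundary_class {R : realType} {X : metricType R} (x : nat -> X) :
    set (nat -> X) :=
  [set y | gromov_seq y /\ asymptotic x y].

(* A point at infinity is the set of the sequences that represent it. These
   sets are equivalence classes as soon as X is Gromov hyperbolic. *)
Record boundary {R : realType} (X : metricType R) := Boundary {
  boundary_seqs :> set (nat -> X) ;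
  boundary_seqsP :
    exists2 x, gromov_seq x & boundary_seqs = boundary_class x }.

HB.instance Definition _ (R : realType) (X : metricType R) :=
  gen_eqMixin (boundary X).
HB.instance Definition _ (R : realType) (X : metricType R) :=
  gen_choiceMixin (boundary X).

Variant bordification {R : realType} (X : metricType R) :=
  | Inside of X
  | AtInfinity of boundary X.

Arguments Inside {R X}.
Arguments AtInfinity {R X}.

HB.instance Definition _ (R : realType) (X : metricType R) :=
  gen_eqMixin (bordification X).
HB.instance Definition _ (R : realType) (X : metricType R) :=
  gen_choiceMixin (bordification X).

Definition represents {R : realType} {X : metricType R}
    (z : bordification X) : set (nat -> X) :=
  match z with
  | Inside p => [set cst p]
  | AtInfinity xi => xi
  end.

(* The points z whose Gromov product with xi, seen from o, is at least r. *)
Definition shadow {R : realType} {X : metricType R}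
    (o : X) (xi : boundary X) (r : R) : set (bordification X) :=
  [set z | exists x y : nat -> X, [/\ boundary_seqs xi x, represents z y &
     \forall ij \near (\oo, \oo), r <= gromov_product o (x ij.1) (y ij.2)]].

(* The usual topology of the union of X and its boundary: X is open in it with
   its metric topology, and the shadows of xi form a neighbourhood basis
   of xi. *)
Section BordificationTopology.
Context {R : realType} {X : metricType R}.

Definition bordification_open : set_system (bordification X) :=
  [set U | open (Inside @^-1` U) /\
    forall xi, U (AtInfinity xi) ->
      forall o, exists r, shadow o xi r `<=` U].

Lemma bordification_openT : bordification_open setT.
Proof. by split; [exact: openT | move=> xi _ o; exists 0]. Qed.

Lemma shadow_le o (xi : boundary X) r s :
  r <= s -> shadow o xi s `<=` shadow o xi r.
Proof.
move=> rs z [x [y [xix zy H]]]; exists x, y; split => //.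
by apply: filterS H => ij; exact: le_trans.
Qed.

Lemma bordification_openI : setI_closed bordification_open.
Proof.
move=> U V [oU shU] [oV shV]; split.
  by rewrite preimage_setI; exact: openI.
move=> xi [Uxi Vxi] o.
have [r rU] := shU _ Uxi o; have [s sV] := shV _ Vxi o.
exists (Num.max r s) => z zrs; split.
  by apply/rU; apply: (shadow_le _ zrs); rewrite le_max lexx.
by apply/sV; apply: (shadow_le _ zrs); rewrite le_max lexx orbT.
Qed.

Lemma bordification_open_bigU (I : Type) (f : I -> set (bordification X)) :
  (forall i, bordification_open (f i)) -> bordification_open (\bigcup_i f i).
Proof.
move=> fo; split.
  by rewrite preimage_bigcup; apply: bigcup_open => i _; have [] := fo i.
move=> xi [i _ fixi] o; have [_ /(_ _ fixi o) [r rf]] := fo i.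
by exists r => z /rf fiz; exists i.
Qed.

HB.instance Definition _ := isOpenTopological.Build (bordification X)
  bordification_openT bordification_openI bordification_open_bigU.

End BordificationTopology.

HB.instance Definition _ (R : realType) (X : metricType R) :=
  Topological.copy (boundary X) (initial_topology (@AtInfinity R X)).

Definition nontrivial {R : realType} (X : metricType R) :=
  `I_3 #<= [set: boundary X].

Definition rough_embedding_on {R : realType} {X Y : metricType R}
    (D : set X) (C : R) (f : X -> Y) :=
  forall p q, D p -> D q -> `|mdist (f p) (f q) - mdist p q| <= C.

Definition rough_isometry {R : realType} {X Y : metricType R}
    (C : R) (f : X -> Y) :=
  rough_embedding_on setT C f /\
  exists L : R, forall y : Y, exists x : X, mdist y (f x) <= L.

Definition rough_geodesic {R : realType} {X : metricType R}
    (K : R) (I : interval R) (c : R^o -> X) :=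
  rough_embedding_on ([set` I] : set R^o) K c.

Definition roughly_geodesic {R : realType} (X : metricType R) (K : R) :=
  forall p q : X, exists (a b : R) (c : R^o -> X),
    [/\ a <= b, rough_geodesic K `[a, b] c, c a = p & c b = q].

Definition rough_ray_to {R : realType} {X : metricType R}
    (K : R) (c : R^o -> X) (xi : boundary X) :=
  rough_geodesic K `[0, +oo[ c /\ Inside (c t) @[t --> +oo] --> AtInfinity xi.

Definition roughly_visual {R : realType} (X : metricType R) (K : R) :=
  forall (p : X) (xi : boundary X),
    exists2 c : R^o -> X, rough_ray_to K c xi & c 0 = p.

Definition roughly_complete {R : realType} (X : metricType R) (K : R) :=
  forall p q : X, exists (c : R^o -> X) (xi : boundary X),
    rough_ray_to K c xi /\
    exists s t : R, [/\ 0 <= s, 0 <= t, c s = p & c t = q].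

Definition roughly_geodesically_complete {R : realType} (X : metricType R) :=
  exists K delta : R, [/\ 0 < K, 0 < delta,
    roughly_geodesic X K /\ gromov_hyperbolic X delta,
    roughly_visual X K & roughly_complete X K].

(* MathComp's actions are restricted to finite groups. *)
Record isometric_action {R : realType} (G : groupType) (X : metricType R) :=
  IsometricAction {
    act :> G -> X -> X ;
    act1 : forall p, act 1%g p = p ;
    actM : forall g h p, act (g * h)%g p = act g (act h p) ;
    act_isometry : forall g p q, mdist (act g p) (act g q) = mdist p q }.

Section BoundaryAction.
Context {R : realType} {G : groupType} {X : metricType R}.
Variable a : isometric_action G X.

Lemma actK g : cancel (a g) (a g^-1%g).
Proof. by move=> p; rewrite -actM mulVg act1. Qed.

Lemma actKV g : cancel (a g^-1%g) (a g).
Proof. by move=> p; rewrite -actM mulgV act1. Qed.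

Lemma gromov_product_act g o p q :
  gromov_product (a g o) (a g p) (a g q) = gromov_product o p q.
Proof. by rewrite /gromov_product !act_isometry. Qed.

Lemma asymptotic_act g (x y : nat -> X) :
  asymptotic x y -> asymptotic (a g \o x) (a g \o y).
Proof.
move=> xy o; rewrite -(actKV g o).
under eq_fun do rewrite /= gromov_product_act.
exact: xy.
Qed.

Lemma boundary_act_subproof g (xi : boundary X) :
  exists2 x, gromov_seq x & [set a g \o y | y in xi] = boundary_class x.
Proof.
have [x gx ->] := boundary_seqsP xi; exists (a g \o x); first exact: asymptotic_act.
apply/seteqP; split => [_ [y [gy xy] <-]|y [gy xy]].
  by split; exact: asymptotic_act.
exists (a g^-1%g \o y); last by apply/funext => n /=; rewrite actKV.
split; first exact: asymptotic_act.
have -> : x = a g^-1%g \o (a g \o x) by apply/funext => n /=; rewrite actK.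
exact: asymptotic_act.
Qed.

Definition boundary_act (g : G) (xi : boundary X) : boundary X :=
  Boundary (boundary_act_subproof g xi).

(* The limit set does not depend on the base point o. *)
Definition limit_set : set (boundary X) :=
  [set xi | exists o : X,
    closure (range (fun g => Inside (a g o))) (AtInfinity xi)].

(* The limit exists and does not depend on o. *)
Definition translation_length (g : G) : R :=
  get [set l : R | forall o : X,
    mdist (a (g ^+ n)%g o) o / n%:R @[n --> \oo] --> l].

Definition hyperbolic (g : G) := 0 < translation_length g.

Definition boundary_fixed (g : G) : set (boundary X) :=
  [set xi | boundary_act g xi = xi].

Definition non_elementary :=
  exists g h : G, [/\ hyperbolic g, hyperbolic h &
    boundary_fixed g `&` boundary_fixed h = set0].

Definition quasi_parabolic :=
  [/\ exists g : G, hyperbolic g,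
      exists! xi : boundary X, forall g, boundary_fixed g xi &
      `I_3 #<= limit_set].

Definition geometrically_dense :=
  (non_elementary \/ quasi_parabolic) /\ limit_set = setT.

End BoundaryAction.

(* The limit sets, seen as types, carry the subspace topology. *)
Definition comparable_actions {R : realType} {G : groupType}
    {X Y : metricType R}
    (a : isometric_action G X) (b : isometric_action G Y) :=
  exists (f : limit_set a -> limit_set b) (h : limit_set b -> limit_set a),
    [/\ cancel f h, cancel h f, continuous f, continuous h &
        forall g (xi eta : limit_set a),
          \val eta = boundary_act a g (\val xi) ->
          \val (f eta) = boundary_act b g (\val (f xi))].

(* Equivariance of maps between metric spaces is meant, as usual for rough
   isometries, up to a uniformly bounded error. Exact equivariance would be too
   much to ask for: it forces the stabilizer of p to fix f p, while an element
   fixing a point of X need not fix any point of Y. *)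
Definition roughly_equivariant {R : realType} {G : groupType}
    {X Y : metricType R}
    (a : isometric_action G X) (b : isometric_action G Y) (f : X -> Y) :=
  exists B : R, forall g p, mdist (f (a g p)) (b g (f p)) <= B.

(* Main.v *)
Require Import Defs.
From HB Require Import structures.
From mathcomp Require Import all_boot all_order all_algebra.
From mathcomp Require Import all_classical all_reals all_analysis.
From mathcomp Require Import lra zify.

Set Implicit Arguments.
Unset Strict Implicit.
Unset Printing Implicit Defensive.

Import Order.TTheory GRing.Theory Num.Theory.
Import numFieldNormedType.Exports.

Local Open Scope classical_set_scope.
Local Open Scope ring_scope.

(** Fix base points [o] and [o']. The theorem reduces to a comparison of the
    orbits of these two points.

    On the one hand, orbits see everything. By rough completeness and density of
    the limit set, every point of [X] is near a geodesic between two points of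
    the orbit of [o] ([orbit_hull]). In a hyperbolic space the position of such a
    point is determined, up to a bounded error, by its distances to the orbit,
    and so are the distances between two such points. If [mdist (g o) o] and
    [mdist (g o') o'] differ by a bounded amount, sending [p] to a point with the
    same distances to the orbit of [o'] is thus a roughly equivariant rough
    isometry ([extend_orbit_map]).

    On the other hand, the orbits are comparable ([orbits_comparable]). When both
    actions are non-elementary, translation lengths suffice. Take powers [u] and
    [v] of independent hyperbolic elements; for every [g] some [s] and [t] among
    [u] and [v] make all turns of the broken line [o, g o, g s o, g s t o, ...]
    obtuse, so that the displacement of [g] exceeds the translation length of
    [g s t] by at most a constant ([non_elementary_displacement]). That length is
    in turn at most the displacement of [g s t] in the other space.

    When the group fixes a point [omega] at infinity, lengths only determine the
    Busemann function: its value at [g o] is, up to a constant, the difference of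
    the translation lengths of [g h^m] and [h^m] for large [m], where [h] is a
    hyperbolic element that repels from [omega] ([focal_busemann_le]). The
    displacement of [g] also depends on the height at which the lines from
    [omega] through [o] and through [g o] diverge. Here the boundary map is used:
    it sends the attracting point of [h] to the attracting point of [h]
    ([attracting_image]), so by continuity it respects divergence at one scale;
    since [h] changes heights by the same amount in both spaces, it respects
    divergence at every scale, with the same constant ([focal_dominated]). *)

(** * Gromov products *)

Section GromovProduct.
Context {R : realType} {X : metricType R}.
Implicit Types o p q r x y z t : X.

Lemma gpE o p q :
  2 * gromov_product o p q = mdist p o + mdist q o - mdist p q.
Proof. by rewrite /gromov_product; lra. Qed.

Lemma gpC o p q : gromov_product o p q = gromov_product o q p.
Proof. by rewrite /gromov_product (metric_sym p q) [_ + mdist q o]addrC. Qed.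

Lemma gp_le o p q : gromov_product o p q <= mdist p o.
Proof.
have := metric_triangle q p o; rewrite (metric_sym q p).
by have := gpE o p q; lra.
Qed.

Lemma gp_lipl o p p' q :
  gromov_product o p q <= gromov_product o p' q + mdist p p'.
Proof.
have := metric_triangle p p' o; have := metric_triangle p' p q.
rewrite (metric_sym p' p).
by have := gpE o p q; have := gpE o p' q; lra.
Qed.

Lemma gp_lipo o o' p q :
  gromov_product o p q <= gromov_product o' p q + mdist o o'.
Proof.
have := metric_triangle p o' o; have := metric_triangle q o' o.
rewrite (metric_sym o' o).
by have := gpE o p q; have := gpE o' p q; lra.
Qed.

Lemma gp_swap o p q :
  gromov_product o p q + gromov_product p o q = mdist o p.
Proof.
have := gpE o p q; have := gpE p o q.
by rewrite (metric_sym p o) (metric_sym q o) (metric_sym q p); lra.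
Qed.

End GromovProduct.

Section Hyperbolicity.
Context {R : realType} {X : metricType R} {delta : R}.
Hypothesis hypX : gromov_hyperbolic X delta.
Implicit Types o p q r x y z t : X.

Lemma delta_ge0 : X -> 0 <= delta.
Proof.
move=> o; have := hypX o o o o.
by rewrite minxx /gromov_product mdistxx; lra.
Qed.

(** The hyperbolicity inequality as a disjunction: with the minimum resolved by
    cases, every later estimate is linear arithmetic in distances. *)
Lemma gp_min o p q r :
  gromov_product o p r <= gromov_product o p q + delta \/
  gromov_product o q r <= gromov_product o p q + delta.
Proof.
have := hypX o p q r; rewrite (gpC o q r) minEle.
by case: ifP => _; [left|right]; lra.
Qed.

Lemma four_point x y z t :
  mdist x y + mdist z t <= mdist x z + mdist y t + 2 * delta \/
  mdist x y + mdist z t <= mdist x t + mdist y z + 2 * delta.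
Proof.
have := gp_min t x y z; have := gpE t x z; have := gpE t x y.
have := gpE t y z.
by move=> ? ? ? []; [left|right]; lra.
Qed.

End Hyperbolicity.

Lemma near_pairP (P : nat * nat -> Prop) :
  (\forall ij \near (\oo, \oo), P ij) <->
  exists N, forall i j, (N <= i)%N -> (N <= j)%N -> P (i, j).
Proof.
split=> [[[A B] /= [[N _ NA] [M _ MB]] AB]|[N NP]].
  exists (maxn N M) => i j Hi Hj; apply: (AB (i, j)); split => /=.
    by apply: NA; rewrite /=; lia.
  by apply: MB; rewrite /=; lia.
exists ([set n | (N <= n)%N], [set n | (N <= n)%N]) => /=.
  by split; exists N.
by move=> [i j] /= [Hi Hj]; exact: NP.
Qed.

Section Asymptotic.
Context {R : realType} {X : metricType R}.
Implicit Types (o p q : X) (x y z : nat -> X).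

(** Sequences, points at infinity and shadows are all compared through this
    relation, which hyperbolicity makes transitive up to [delta]. *)
Definition gp_eventually o x y (r : R) :=
  exists N, forall i j, (N <= i)%N -> (N <= j)%N ->
    r <= gromov_product o (x i) (y j).

Lemma gp_eventuallyP o x y r :
  (\forall ij \near (\oo, \oo), r <= gromov_product o (x ij.1) (y ij.2)) <->
  gp_eventually o x y r.
Proof.
split=> [/near_pairP[N NP]|[N NP]]; last by apply/near_pairP; exists N.
by exists N => i j; exact: NP.
Qed.

Lemma asymptoticP x y :
  asymptotic x y <-> forall o r, gp_eventually o x y r.
Proof.
split=> [xy o r|xy o].
  by have /cvgryPge/(_ r)/gp_eventuallyP := xy o.
by apply/cvgryPge => r; apply/gp_eventuallyP; exact: xy.
Qed.

Lemma asymptotic_at o x y :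
  (forall r, gp_eventually o x y r) -> asymptotic x y.
Proof.
move=> xy; apply/asymptoticP => o' r.
have [N NP] := xy (r + mdist o o'); exists N => i j Hi Hj.
by have := NP i j Hi Hj; have := gp_lipo o o' (x i) (y j); lra.
Qed.

Lemma gp_eventually_le o x y r s :
  r <= s -> gp_eventually o x y s -> gp_eventually o x y r.
Proof.
by move=> rs [N NP]; exists N => i j Hi Hj; apply: le_trans (NP i j Hi Hj).
Qed.

Lemma gp_eventually_sym o x y r :
  gp_eventually o x y r -> gp_eventually o y x r.
Proof. by move=> [N NP]; exists N => i j Hi Hj; rewrite gpC; exact: NP. Qed.

Lemma asymptotic_sym x y : asymptotic x y -> asymptotic y x.
Proof.
by move=> /asymptoticP xy; apply/asymptoticP => o r; exact: gp_eventually_sym.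
Qed.

Lemma gp_eventually_lipo o o' x y r :
  gp_eventually o x y r -> gp_eventually o' x y (r - mdist o o').
Proof.
move=> [N NP]; exists N => i j Hi Hj.
by have := NP i j Hi Hj; have := gp_lipo o o' (x i) (y j); lra.
Qed.

Context {delta : R} (hypX : gromov_hyperbolic X delta).

Lemma gp_eventually_trans o x y z r :
  gp_eventually o x y r -> gp_eventually o y z r ->
  gp_eventually o x z (r - delta).
Proof.
move=> [N NP] [M MP]; exists (maxn N M) => i j Hi Hj.
have h1 := NP i (maxn N M) ltac:(lia) ltac:(lia).
have h2 := MP (maxn N M) j ltac:(lia) ltac:(lia).
have := gp_min hypX o (x i) (z j) (y (maxn N M)).
by rewrite (gpC o (z j)) => -[]; lra.
Qed.

Lemma asymptotic_trans x y z :
  asymptotic x y -> asymptotic y z -> asymptotic x z.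
Proof.
move=> /asymptoticP xy /asymptoticP yz; apply/asymptoticP => o r.
have := gp_eventually_trans (xy o (r + delta)) (yz o (r + delta)).
by rewrite addrK.
Qed.

End Asymptotic.

(** * Points at infinity and their shadows *)

Section Boundary.
Context {R : realType} {X : metricType R}.
Context {delta : R} (hypX : gromov_hyperbolic X delta).
Implicit Types (o p q : X) (x y z : nat -> X) (xi eta zeta : boundary X).

Lemma boundary_eq xi eta : boundary_seqs xi = boundary_seqs eta -> xi = eta.
Proof.
case: xi eta => [A HA] [B HB] /= AB; rewrite AB in HA *.
by congr Boundary; exact: Prop_irrelevance.
Qed.

Lemma boundary_gromov xi x : boundary_seqs xi x -> gromov_seq x.
Proof. by have [y gy ->] := boundary_seqsP xi => -[]. Qed.

Lemma boundary_inh xi : exists x, boundary_seqs xi x.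
Proof. by have [x gx ->] := boundary_seqsP xi; exists x. Qed.

Lemma boundary_asymptotic xi x y :
  boundary_seqs xi x -> boundary_seqs xi y -> asymptotic x y.
Proof.
have [z gz ->] := boundary_seqsP xi => -[gx zx] [gy zy].
exact: (asymptotic_trans hypX (asymptotic_sym zx) zy).
Qed.

Lemma boundary_mem xi x y :
  boundary_seqs xi x -> gromov_seq y -> asymptotic x y -> boundary_seqs xi y.
Proof.
have [z gz ->] := boundary_seqsP xi => -[gx zx] gy xy.
by split => //; exact: (asymptotic_trans hypX zx xy).
Qed.

(** Equality of points at infinity is always established through one pair of
    asymptotic representatives. *)
Lemma boundary_meet xi eta x y :
  boundary_seqs xi x -> boundary_seqs eta y -> asymptotic x y -> xi = eta.
Proof.
move=> xix etay xy; apply: boundary_eq; apply/seteqP; split=> z Hz.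
  apply: (boundary_mem etay); first exact: boundary_gromov Hz.
  apply: (asymptotic_trans hypX (asymptotic_sym xy)).
  exact: boundary_asymptotic xix Hz.
apply: (boundary_mem xix); first exact: boundary_gromov Hz.
apply: (asymptotic_trans hypX xy).
exact: boundary_asymptotic etay Hz.
Qed.

Definition boundary_of x (gx : gromov_seq x) : boundary X :=
  Boundary (ex_intro2 _ _ x gx erefl).

Lemma shadow_boundaryP o xi eta r :
  shadow o xi r (AtInfinity eta) <->
  exists x y, [/\ boundary_seqs xi x, boundary_seqs eta y &
                  gp_eventually o x y r].
Proof.
split=> -[x [y [xix etay H]]]; exists x, y; split => //;
  last exact/gp_eventuallyP.
by move/gp_eventuallyP: H.
Qed.

Lemma shadow_insideP o xi p r :
  shadow o xi r (Inside p) <->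
  exists2 x, boundary_seqs xi x & gp_eventually o x (cst p) r.
Proof.
split=> [[x [_ [xix -> /gp_eventuallyP H]]]|[x xix H]]; first by exists x.
by exists x, (cst p); split => //; apply/gp_eventuallyP.
Qed.

(** A shadow asks for one pair of representatives; the choice costs [delta] on
    either side. *)
Lemma shadow_all o xi eta r x y :
  shadow o xi r (AtInfinity eta) -> boundary_seqs xi x -> boundary_seqs eta y ->
  gp_eventually o x y (r - 2 * delta).
Proof.
move=> /shadow_boundaryP[x' [y' [xix' etay' H]]] xix etay.
have /asymptoticP/(_ o r) h1 := boundary_asymptotic xix xix'.
have /asymptoticP/(_ o (r - delta)) h2 := boundary_asymptotic etay' etay.
have := gp_eventually_trans hypX (gp_eventually_trans hypX h1 H) h2.
by apply: gp_eventually_le; lra.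
Qed.

Lemma shadow_inside_all o xi p r x :
  shadow o xi r (Inside p) -> boundary_seqs xi x ->
  gp_eventually o x (cst p) (r - delta).
Proof.
move=> /shadow_insideP[x' xix' H] xix.
have /asymptoticP/(_ o r) h1 := boundary_asymptotic xix xix'.
exact: (gp_eventually_trans hypX h1 H).
Qed.

Lemma shadow_lipo o o' xi r :
  shadow o xi (r + mdist o o') `<=` shadow o' xi r.
Proof.
move=> z [x [y [xix zy /gp_eventuallyP/gp_eventually_lipo H]]].
exists x, y; split => //; apply/gp_eventuallyP.
by have := H o'; rewrite addrK.
Qed.

Lemma shadow_shadow o xi eta zz r :
  shadow o xi (r + 3 * delta) (AtInfinity eta) ->
  shadow o eta (r + 3 * delta) zz -> shadow o xi r zz.
Proof.
move=> h [x [y [etax zzy /gp_eventuallyP H]]].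
have [z xiz] := boundary_inh xi.
exists z, y; split => //; apply/gp_eventuallyP.
have h1 := shadow_all h xiz etax.
have dge0 := delta_ge0 hypX o.
have h2 : gp_eventually o x y (r + 3 * delta - 2 * delta).
  by apply: gp_eventually_le H; lra.
by have := gp_eventually_trans hypX h1 h2; apply: gp_eventually_le; lra.
Qed.

(** A shadow need not be open, but the points it contains together with a whole
    smaller shadow around them form an open set: this is where hyperbolicity
    makes shadows a neighbourhood basis. *)
Lemma nbhs_shadow o xi r : nbhs (AtInfinity xi) (shadow o xi r).
Proof.
pose S := shadow o xi r.
pose W : set (bordification X) := [set z | match z with
  | Inside p => interior (Inside @^-1` S) p
  | AtInfinity eta => exists s, shadow o eta s `<=` S end].
have WS : W `<=` S.
  move=> [p|eta] /=; first by move/nbhs_singleton.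
  move=> [s]; apply; have [x etax] := boundary_inh eta.
  apply/shadow_boundaryP; exists x, x; split => //.
  by have /asymptoticP := boundary_gromov etax; apply.
exists W; split => //; last by exists r.
split; first exact: open_interior.
move=> eta [s sS] o'; pose t := s + 3 * delta + 1.
exists (t + mdist o' o) => z /shadow_lipo etaz.
have dge0 := delta_ge0 hypX o.
case: z etaz => [p|zeta] etaz /=.
  apply/nbhs_ballP; exists 1 => //= q; rewrite ballEmdist /= => pq.
  apply: sS; apply/shadow_insideP; move/shadow_insideP: etaz => [x etax H].
  exists x => //; move: H => [N NP]; exists N => i j Hi Hj.
  have := NP i j Hi Hj; rewrite /cst.
  have := gp_lipl o p q (x i); rewrite !(gpC _ (x i)) /t; lra.
exists t => z' zetaz'; apply: sS.
apply: (@shadow_shadow o eta zeta).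
  by apply: (shadow_le _ etaz); rewrite /t; lra.
by apply: (shadow_le _ zetaz'); rewrite /t; lra.
Qed.

End Boundary.

(** * Linear growth of subadditive sequences *)

Section Rates.
Context {R : realType}.
Implicit Types (u v : nat -> R) (l c K : R).

Lemma archi_gt (x : R) : exists n : nat, x < n%:R.
Proof.
exists (Num.bound `|x|); apply: le_lt_trans (ler_norm x) _.
exact: archi_boundP.
Qed.

Lemma archi_mul (c x : R) : 0 < c -> exists n : nat, x < n%:R * c.
Proof.
by move=> c0; have [n xn] := archi_gt (x / c); exists n; rewrite -ltr_pdivrMr.
Qed.

(** The limit [l] of [u n / n], which for a subadditive sequence is also a
    lower bound. *)
Definition rate u l :=
  (forall n, n%:R * l <= u n) /\
  (forall e, 0 < e -> exists N, forall n, (N <= n)%N -> u n <= n%:R * (l + e)).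

Lemma subadditive_mul u (u0 : u 0%N = 0) :
  (forall m n, u (m + n)%N <= u m + u n) ->
  forall k m, u (k * m)%N <= k%:R * u m.
Proof.
move=> uD; elim=> [|k IH] m; first by rewrite mul0n u0 mul0r.
rewrite mulSn -natr1; have := uD m (k * m)%N; have := IH m; lra.
Qed.

(** Fekete: a nonnegative subadditive sequence has a rate, namely the infimum
    of [u n / n]. *)
Lemma subadditive_rate u (u0 : u 0%N = 0) (u_ge0 : forall n, 0 <= u n) :
  (forall m n, u (m + n)%N <= u m + u n) -> exists l, rate u l.
Proof.
move=> uD; pose A := [set u n.+1 / n.+1%:R | n in [set: nat]].
have A0 : A !=set0 by exists (u 1%N / 1); exists 0%N.
have Alb : has_lbound A.
  by exists 0 => _ [n _ <-]; rewrite divr_ge0.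
exists (inf A); split=> [[|n]|e e0].
- by rewrite u0 mul0r.
- rewrite mulrC -ler_pdivlMr ?ltr0Sn //; apply: ge_inf => //.
  by exists n.
have [_ [m _ <-] hm] := inf_adherent (divr_gt0 e0 (ltr0Sn R 1)) (conj A0 Alb).
have m0 : 0 < m.+1%:R :> R by [].
move: hm; rewrite ltr_pdivrMr // => hm.
have [N hN] := @archi_mul (e / 2) (m.+1%:R * u 1%N) ltac:(lra).
exists N => n Nn; rewrite {1}(divn_eq n m.+1).
apply: le_trans (uD _ _) _.
have h1 := subadditive_mul u0 uD (n %/ m.+1) m.+1.
have h2 := subadditive_mul u0 uD (n %% m.+1) 1; rewrite muln1 in h2.
have h3 : (n %% m.+1)%:R * u 1%N <= m.+1%:R * u 1%N.
  by apply: ler_wpM2r => //; rewrite ler_nat ltnW // ltn_pmod.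
have h4 : (n %/ m.+1)%:R * u m.+1 <= (n %/ m.+1 * m.+1)%:R * (inf A + e / 2).
  by rewrite natrM -mulrA; apply: ler_wpM2l => //; rewrite mulrC; exact: ltW.
have l0 : 0 <= inf A by apply: lb_le_inf => // _ [k _ <-]; rewrite divr_ge0.
have h5 : (n %/ m.+1 * m.+1)%:R * (inf A + e / 2) <= n%:R * (inf A + e / 2).
  apply: ler_wpM2r; first lra.
  by rewrite ler_nat leq_trunc_div.
have h6 : N%:R * (e / 2) <= n%:R * (e / 2).
  by apply: ler_wpM2r; [lra|rewrite ler_nat].
rewrite mulrDr in h5; lra.
Qed.

Lemma rate_cvg u l : rate u l -> u n / n%:R @[n --> \oo] --> l.
Proof.
move=> [lu ul]; apply/cvgrPdist_le => e e0.
have [N hN] := ul e e0.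
exists N.+1 => //= n; rewrite /mkset => Nn.
have n0 : 0 < n%:R :> R by rewrite ltr0n; lia.
have h1 := hN n (ltnW Nn); have h2 := lu n.
rewrite distrC ler_norml; apply/andP; split.
  by rewrite lerBrDr ler_pdivlMr //; have := mulr_gt0 n0 e0; lra.
by rewrite lerBlDr ler_pdivrMr // mulrC addrC.
Qed.

Lemma rate_ge u l m c K : rate u l -> (0 < m)%N ->
  (forall k, k%:R * c - K <= u (k * m)%N) -> c <= m%:R * l.
Proof.
move=> [_ ul] m0 h; rewrite leNgt; apply/negP => lc.
have mr0 : 0 < m%:R :> R by rewrite ltr0n.
(* Half of the gap c - m * l, spread over the m steps of one period. *)
pose e := (c - m%:R * l) / 2 / m%:R.
have e0 : 0 < e by rewrite /e !divr_gt0 //; lra.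
have me : m%:R * e = (c - m%:R * l) / 2.
  by rewrite /e mulrC divfK // gt_eqF.
have [N hN] := ul e e0.
have [k hk] := @archi_mul ((c - m%:R * l) / 2) K ltac:(lra).
have h1 := hN ((maxn N k) * m)%N ltac:(nia); have h2 := h (maxn N k).
have : k%:R * ((c - m%:R * l) / 2) <= (maxn N k)%:R * ((c - m%:R * l) / 2).
  by apply: ler_wpM2r; [lra|rewrite ler_nat; lia].
move: h1; rewrite natrM -mulrA mulrDr me; lra.
Qed.

(** Otherwise [u (2 ^ k)] would grow only linearly in [k]. *)
Lemma rate_unbounded_doubling u l K : rate u l -> 0 < l ->
  exists r, (0 < r)%N /\ K < u (r + r)%N - u r.
Proof.
move=> [lu _] l0; apply: contrapT => hN.
have h r : (0 < r)%N -> u (r + r)%N <= u r + K.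
  move=> r0; rewrite leNgt; apply/negP => Kr; apply: hN; exists r; split=> //.
  lra.
have h2 k : u (2 ^ k)%N <= u 1%N + k%:R * K.
  elim: k => [|k IH]; first by rewrite mul0r addr0.
  rewrite expnS mul2n -addnn -natr1.
  by have := h (2 ^ k)%N; rewrite expn_gt0 => /(_ isT); lra.
have [n hn] := @archi_mul l (`|u 1%N| + 2 * `|K|) l0.
have h3 := h2 (n.+1 + n.+1)%N; have h4 := lu (2 ^ (n.+1 + n.+1))%N.
have h5 : (n.+1 * n.+1)%:R <= (2 ^ (n.+1 + n.+1))%:R :> R.
  by rewrite ler_nat expnD; apply: leq_mul; apply/ltnW/ltn_expl.
have h6 : (n.+1 * n.+1)%:R * l <= (2 ^ (n.+1 + n.+1))%:R * l.
  by apply: ler_wpM2r => //; exact: ltW.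
have n0 : 1 <= n.+1%:R :> R by rewrite ler1n.
have hn1 : `|u 1%N| + 2 * `|K| < n.+1%:R * l.
  by apply: lt_le_trans hn _; apply: ler_wpM2r; [exact: ltW|rewrite ler_nat].
have h7 : n.+1%:R * (`|u 1%N| + 2 * `|K|) < n.+1%:R * (n.+1%:R * l).
  by rewrite ltr_pM2l //; lra.
move: h3 h6; rewrite natrM natrD => h3 h6.
(* A quadratic lower bound in n.+1 exceeds the linear upper one. *)
have := ler_norm (u 1%N); have := ler_norm K; have := normr_ge0 (u 1%N).
have := normr_ge0 K; nra.
Qed.

(** In this form the displacements of the powers of a hyperbolic isometry are
    seen to stay at bounded distance from a linear function. Once doubling an
    exponent [r] gains more than the four-point error, that condition forbids
    any further backtracking, which makes [u] almost superadditive along the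
    multiples of [r]. *)
Lemma rate_hyperbolic u l D (u0 : u 0%N = 0) :
  (forall m n, u (m + n)%N <= u m + u n) ->
  (forall i j r, u (i + r)%N + u (j + r)%N <= u i + u j + 2 * D \/
     u (i + r)%N + u (j + r)%N <= u (i + j + r)%N + u r + 2 * D) ->
  0 <= D -> (forall n, 0 <= u n) ->
  rate u l -> 0 < l -> exists K, forall n, u n <= n%:R * l + K.
Proof.
move=> uD four D0 u_ge0 ul l0.
have [r [r0 hr]] := rate_unbounded_doubling (3 * D) ul l0.
pose v n := u (n * r)%N; pose c := v 2%N - v 1%N - 2 * D.
have v0 : v 0%N = 0 by rewrite /v mul0n.
have vr : u r = v 1%N by rewrite /v mul1n.
have cD : D < c by rewrite /c /v mul1n mul2n -addnn; lra.
have vstep n : v n + c <= v n.+1.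
  elim: n => [|n IH].
    rewrite v0 /c; have := uD r r; rewrite /v mul2n -addnn mul1n; lra.
  have := four r (n * r)%N r.
  have -> : (r + r = 2 * r)%N by lia.
  have -> : (n * r + r = n.+1 * r)%N by lia.
  have -> : (r + n * r + r = n.+2 * r)%N by lia.
  rewrite -!/(v _) vr; move: cD IH; rewrite /c => ? ? -[]; lra.
pose K := 2 * v 1%N + 2 * D.
(* Two steps of size c > D together exceed the error 2 * D, which excludes the
   first case of the four-point condition. *)
have vsup i j : v i + v j <= v (i + j)%N + K.
  have := four (i * r)%N (j * r)%N r.
  have -> : (i * r + r = i.+1 * r)%N by lia.
  have -> : (j * r + r = j.+1 * r)%N by lia.
  have -> : (i * r + j * r + r = (i + j).+1 * r)%N by lia.
  rewrite -!/(v _) vr; have := vstep i; have := vstep j.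
  have : v (i + j).+1 <= v (i + j)%N + v 1%N.
    by have := uD ((i + j) * r)%N (1 * r)%N; rewrite -mulnDl addn1.
  by rewrite /K => h1 h2 h3 []; lra.
have vmul n k : k%:R * (v n - K) - K <= v (k * n)%N.
  elim: k => [|k IH]; last first.
    by have := vsup n (k * n)%N; rewrite mulSn -natr1; lra.
  rewrite mul0r mul0n v0; have := u_ge0 r; rewrite /K /v mul1n; lra.
have vle n : v n <= (n * r)%:R * l + K.
  have [->|n0] := posnP n.
    rewrite v0 mul0n mul0r; have := u_ge0 r; rewrite /K /v mul1n; lra.
  have : v n - K <= (n * r)%:R * l.
    apply: (@rate_ge _ _ _ _ K ul); first by rewrite muln_gt0 n0.
    by move=> k; have := vmul n k; rewrite /v mulnA.
  lra.
exists (K + r%:R * u 1%N) => n.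
rewrite {1}(divn_eq n r); apply: le_trans (uD _ _) _.
have h1 := vle (n %/ r)%N.
have h2 := subadditive_mul u0 uD (n %% r) 1; rewrite muln1 in h2.
have h3 : (n %% r)%:R * u 1%N <= r%:R * u 1%N.
  by apply: ler_wpM2r => //; rewrite ler_nat ltnW // ltn_pmod.
have h4 : (n %/ r * r)%:R * l <= n%:R * l.
  by apply: ler_wpM2r; [exact: ltW|rewrite ler_nat leq_trunc_div].
rewrite /v in h1; lra.
Qed.

End Rates.

(** * Translation lengths *)

Section Displacement.
Context {R : realType} {G : groupType} {X : metricType R}.
Variable a : isometric_action G X.
Implicit Types (g h : G) (o p q : X) (m n : nat).

Lemma actV_dist g p q : mdist (a g^-1%g p) q = mdist p (a g q).
Proof. by rewrite -(act_isometry a g) actKV. Qed.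

Lemma act_expD g m n p : a (g ^+ (m + n))%g p = a (g ^+ m)%g (a (g ^+ n)%g p).
Proof. by rewrite expgnDr actM. Qed.

Lemma orbit_dist g o m n :
  mdist (a (g ^+ m)%g o) (a (g ^+ (m + n))%g o) = mdist (a (g ^+ n)%g o) o.
Proof. by rewrite act_expD act_isometry metric_sym. Qed.

Lemma orbit_distV g o m n :
  mdist (a (g ^+ m)%g o) (a (g^-1 ^+ n)%g o) = mdist (a (g ^+ (m + n))%g o) o.
Proof. by rewrite metric_sym expVgn actV_dist metric_sym addnC act_expD. Qed.

Lemma inv_dist g o : mdist (a g^-1%g o) o = mdist (a g o) o.
Proof. by rewrite actV_dist metric_sym. Qed.

(** Subadditivity makes the limit exist at every base point, and changing the
    base point changes displacements by a bounded amount: so the chosen value is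
    the limit. *)
Lemma rate_translation_length g o :
  rate (fun n => mdist (a (g ^+ n)%g o) o) (translation_length a g).
Proof.
have R1 p : exists l, rate (fun n => mdist (a (g ^+ n)%g p) p) l.
  apply: subadditive_rate => [|n|m n].
  - by rewrite act1 mdistxx.
  - exact: mdist_ge0.
  - have := metric_triangle (a (g ^+ (m + n))%g p) (a (g ^+ m)%g p) p.
    rewrite [in mdist (a (g ^+ (m + n))%g p) (a _ _)]metric_sym orbit_dist.
    by rewrite addrC.
have [l Rl] := R1 o; pose u p n := mdist (a (g ^+ n)%g p) p.
have upq p q n : u p n <= u q n + 2 * mdist p q.
  have := metric_triangle (a (g ^+ n)%g p) (a (g ^+ n)%g q) p.
  have := metric_triangle (a (g ^+ n)%g q) q p.
  by rewrite act_isometry (metric_sym q p) /u; lra.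
have R2 p : rate (u p) l.
  have [l' Rl'] := R1 p; suff -> : l = l' by [].
  have key q q' s s' : rate (u q) s -> rate (u q') s' -> s <= s'.
    move=> [qs _] Rs'; rewrite -(mul1r s').
    apply: (@rate_ge _ _ _ 1%N s (2 * mdist q q') Rs') => // k.
    by rewrite muln1; have := qs k; have := upq q q' k; lra.
  by apply/eqP; rewrite eq_le (key o p) // (key p o).
pose L := [set l : R | forall p : X,
    mdist (a (g ^+ n)%g p) p / n%:R @[n --> \oo] --> l].
have Ll : L l by move=> p; exact: rate_cvg (R2 p).
have /(_ o) := @getPex _ L (ex_intro _ l Ll).
rewrite -/(translation_length a g) => cv.
suff <- : l = translation_length a g by exact: R2.
by apply: (@cvg_unique _ (@Rhausdorff R) _ _ _ _ (Ll o) cv).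
Qed.

Lemma translation_length_le g o : translation_length a g <= mdist (a g o) o.
Proof. by have [/(_ 1%N)] := rate_translation_length g o; rewrite mul1r. Qed.

Lemma translation_length_ge g o c K :
  (forall n, n%:R * c - K <= mdist (a (g ^+ n)%g o) o) ->
  c <= translation_length a g.
Proof.
move=> h; rewrite -[leRHS]mul1r.
apply: (@rate_ge _ _ _ 1%N c K (rate_translation_length g o)) => // k.
by rewrite muln1.
Qed.

Lemma translation_length_ge0 g (o : X) : 0 <= translation_length a g.
Proof.
apply: (@translation_length_ge g o 0 0) => n.
by rewrite mulr0 subr0; exact: mdist_ge0.
Qed.

Lemma translation_lengthV g (o : X) :
  translation_length a g^-1%g = translation_length a g.
Proof.
have E n : mdist (a (g^-1 ^+ n)%g o) o = mdist (a (g ^+ n)%g o) o.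
  by rewrite expVgn inv_dist.
apply/eqP; rewrite eq_le; apply/andP; split.
  apply: (@translation_length_ge g o _ 0) => n.
  by rewrite subr0 -E; have [] := rate_translation_length g^-1%g o.
apply: (@translation_length_ge g^-1%g o _ 0) => n.
by rewrite subr0 E; have [] := rate_translation_length g o.
Qed.

Context {delta : R} (hypX : gromov_hyperbolic X delta).

(** If [g * g] displaces [o] further than [g] does by more than [2 * delta], the
    four-point condition makes the excess accumulate at every further power. *)
Lemma translation_length_jump g o :
  mdist (a (g * g)%g o) o - mdist (a g o) o - 2 * delta
    <= translation_length a g.
Proof.
set c := _ - _; have [c0|c0] := leP c 0.
  by apply: le_trans c0 _; exact: translation_length_ge0 o.
pose u n := mdist (a (g ^+ n)%g o) o.
have d0 := delta_ge0 hypX o.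
have tri : u 2%N <= u 1%N + u 1%N.
  have := metric_triangle (a (g ^+ 2)%g o) (a g o) o.
  by rewrite metric_sym (metric_sym _ (a g o)) (orbit_dist g o 1 1) metric_sym.
have step n : u n + c <= u n.+1.
  elim: n => [|n IH].
    by rewrite /u act1 mdistxx; move: tri; rewrite /u /c /= expg1 expg2; lra.
  have := four_point hypX o (a (g ^+ 2)%g o) (a (g ^+ 1)%g o)
    (a (g ^+ n.+2)%g o).
  rewrite (orbit_dist g o 1 n.+1) (orbit_dist g o 2 n).
  rewrite (metric_sym (a (g ^+ 2)%g o) (a _ _)) (orbit_dist g o 1 1).
  rewrite !(metric_sym o) -!/(u _) /c -/(u 2) -/(u 1).
  by move: IH c0; rewrite /c -/(u 2) -/(u 1) => IH c0 [|]; lra.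
apply: (@translation_length_ge g o _ 0) => n; rewrite subr0 -/(u n).
elim: n => [|n IH]; first by rewrite mul0r mdist_ge0.
by rewrite -natr1; have := step n; lra.
Qed.

Lemma hyperbolic_axis g o : hyperbolic a g ->
  exists K, [/\ 0 <= K, forall n,
      n%:R * translation_length a g <= mdist (a (g ^+ n)%g o) o &
    forall n, mdist (a (g ^+ n)%g o) o <= n%:R * translation_length a g + K].
Proof.
move=> hg; have Ru := rate_translation_length g o.
have [] := @rate_hyperbolic _ _ _ delta _ _ _ _ _ Ru hg.
- by rewrite act1 mdistxx.
- move=> m n; have := metric_triangle (a (g ^+ (m + n))%g o) (a (g ^+ m)%g o) o.
  rewrite [in mdist (a (g ^+ (m + n))%g o) (a _ _)]metric_sym orbit_dist.
  by rewrite addrC.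
- move=> i j r.
  have := four_point hypX o (a (g ^+ (i + r))%g o) (a (g ^+ i)%g o)
    (a (g ^+ (i + r + j))%g o).
  have e : mdist (a (g ^+ i)%g o) (a (g ^+ (i + r + j))%g o) =
      mdist (a (g ^+ (j + r))%g o) o by rewrite -addnA orbit_dist addnC.
  rewrite e orbit_dist (metric_sym (a (g ^+ (i + r))%g o)) orbit_dist.
  by rewrite !(metric_sym o) (_ : i + r + j = i + j + r)%N //; lia.
- exact: delta_ge0 hypX o.
- by move=> n; exact: mdist_ge0.
move=> K hK; exists K; split => //; last by case: Ru.
by have := hK 0%N; rewrite mul0r add0r; apply: le_trans; exact: mdist_ge0.
Qed.

End Displacement.

(** * Hyperbolic elements at infinity *)

Section Dynamics.
Context {R : realType} {G : groupType} {X : metricType R}.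
Variable a : isometric_action G X.
Context {delta : R} (hypX : gromov_hyperbolic X delta).
Implicit Types (g h : G) (o p q : X) (m n : nat) (xi eta : boundary X).

Definition orbit_seq g o : nat -> X := fun n => a (g ^+ n)%g o.

Lemma hyperbolicV g (o : X) : hyperbolic a g -> hyperbolic a g^-1%g.
Proof. by rewrite /hyperbolic (translation_lengthV a g o). Qed.

(** The powers of a hyperbolic element draw a line with two distinct ends:
    Gromov products grow within either half and stay bounded across. *)
Lemma orbit_gromov_product g o : hyperbolic a g -> exists K, [/\ 0 <= K,
  forall n i j, (n <= i)%N -> (n <= j)%N ->
    n%:R * translation_length a g - K
      <= gromov_product o (orbit_seq g o i) (orbit_seq g o j) &
  forall i j,
    gromov_product o (orbit_seq g o i) (orbit_seq g^-1%g o j) <= K].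
Proof.
move=> hg; have [K [K0 lu ul]] := hyperbolic_axis hypX o hg.
have key n i j : (n <= i)%N -> (i <= j)%N -> n%:R * translation_length a g - K
      <= gromov_product o (orbit_seq g o i) (orbit_seq g o j).
  move=> ni ij; have := gpE o (orbit_seq g o i) (orbit_seq g o j).
  rewrite /orbit_seq -{3}(subnKC ij) orbit_dist.
  have := lu i; have := lu j; have := ul (j - i)%N; rewrite natrB // mulrBl.
  have : n%:R * translation_length a g <= i%:R * translation_length a g.
    by apply: ler_wpM2r; [exact: ltW|rewrite ler_nat].
  by lra.
exists K; split=> // [n i j ni nj|i j].
  by have [ij|/ltnW ji] := leqP i j; [|rewrite gpC]; apply: key.
have := gpE o (orbit_seq g o i) (orbit_seq g^-1%g o j).
rewrite /orbit_seq orbit_distV expVgn inv_dist.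
have := lu (i + j)%N; have := ul i; have := ul j; rewrite natrD mulrDl; lra.
Qed.

Lemma orbit_gromov_seq g o : hyperbolic a g -> gromov_seq (orbit_seq g o).
Proof.
move=> hg; have [K [_ hK _]] := orbit_gromov_product o hg.
apply: (@asymptotic_at _ _ o) => r.
have [N hN] := @archi_mul R _ (r + K) hg; exists N => i j Ni Nj.
by have := hK N i j Ni Nj; lra.
Qed.

Lemma orbit_not_asymptotic g o : hyperbolic a g ->
  ~ asymptotic (orbit_seq g o) (orbit_seq g^-1%g o).
Proof.
move=> hg /asymptoticP/(_ o) A; have [K [_ _ hK]] := orbit_gromov_product o hg.
have [N hN] := A (K + 1).
by have := hN N N (leqnn _) (leqnn _); have := hK N N; lra.
Qed.

(** One large Gromov product between far terms of two Gromov sequences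
    propagates to all far terms. *)
Lemma not_asymptotic_bounded o (y z : nat -> X) :
  gromov_seq y -> gromov_seq z -> ~ asymptotic y z ->
  exists C M, forall i j, (M <= i)%N -> (M <= j)%N ->
    gromov_product o (y i) (z j) <= C.
Proof.
move=> /asymptoticP yy /asymptoticP zz yz; apply: contrapT => hN; apply: yz.
apply: (@asymptotic_at _ _ o) => r.
have [M1 h1] := yy o (r + 2 * delta); have [M2 h2] := zz o (r + 2 * delta).
pose M := maxn M1 M2; exists M => i j Mi Mj.
apply: contrapT => /negP; rewrite -ltNge => ijr; apply: hN.
exists (r + 2 * delta), M => i' j' Mi' Mj'.
have d0 := delta_ge0 hypX o.
rewrite leNgt; apply/negP => h.
have := h1 i i' ltac:(lia) ltac:(lia); have := h2 j j' ltac:(lia) ltac:(lia).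
have := gp_min hypX o (y i) (z j) (y i').
have := gp_min hypX o (y i') (z j) (z j').
rewrite (gpC o (z j) (y i')).
by move=> [?|?] [?|?]; lra.
Qed.

Lemma boundary_act_mem g xi y :
  boundary_seqs xi y -> boundary_seqs (boundary_act a g xi) (a g \o y).
Proof. by move=> xiy; exists y. Qed.

Lemma asymptotic_near (x y : nat -> X) B :
  gromov_seq x -> (forall n, mdist (x n) (y n) <= B) -> asymptotic x y.
Proof.
move=> /asymptoticP xx xy; apply/asymptoticP => o r.
have [N hN] := xx o (r + B); exists N => i j Ni Nj.
have := hN i j Ni Nj; have := gp_lipl o (x j) (y j) (x i).
by have := xy j; rewrite !(gpC o _ (x i)); lra.
Qed.

Lemma orbit_fixed g o xi : hyperbolic a g ->
  boundary_seqs xi (orbit_seq g o) -> boundary_fixed a g xi.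
Proof.
move=> hg xio; apply: (boundary_meet hypX (boundary_act_mem g xio) xio).
apply: asymptotic_sym; apply: (@asymptotic_near _ _ (mdist o (a g o))).
  exact: orbit_gromov_seq.
by move=> n; rewrite /= /orbit_seq -actM -expgS expgSr actM act_isometry.
Qed.

Lemma boundary_act1 xi : boundary_act a 1%g xi = xi.
Proof.
have [x xix] := boundary_inh xi.
apply: (boundary_meet hypX (boundary_act_mem 1%g xix) xix).
have -> : a 1%g \o x = x by apply/funext => n; rewrite /= act1.
exact: boundary_gromov xix.
Qed.

Lemma boundary_actM g h xi :
  boundary_act a (g * h)%g xi = boundary_act a g (boundary_act a h xi).
Proof.
have [x xix] := boundary_inh xi.
have m1 := boundary_act_mem (g * h)%g xix.
apply: (boundary_meet hypX m1
  (boundary_act_mem g (boundary_act_mem h xix))).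
have -> : a g \o (a h \o x) = a (g * h)%g \o x.
  by apply/funext => n; rewrite /= actM.
exact: boundary_gromov m1.
Qed.

Lemma boundary_fixedV g xi :
  boundary_fixed a g xi -> boundary_fixed a g^-1%g xi.
Proof.
by move=> gx; rewrite /boundary_fixed /= -{1}gx -boundary_actM mulVg boundary_act1.
Qed.

Lemma boundary_fixedX g n xi :
  boundary_fixed a g xi -> boundary_fixed a (g ^+ n)%g xi.
Proof.
move=> gx; elim: n => [|n IH]; first exact: boundary_act1.
by rewrite /boundary_fixed /= expgS boundary_actM IH.
Qed.

(** North-south dynamics: a point at infinity other than the repelling one,
    which [orbit_seq h^-1 o] represents, is attracted to the other one. *)
Lemma north_south h o eta xi : hyperbolic a h ->
  boundary_seqs eta (orbit_seq h o) ->
  ~ boundary_seqs xi (orbit_seq h^-1%g o) ->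
  forall r, exists N, forall n, (N <= n)%N ->
    shadow o eta r (AtInfinity (boundary_act a (h ^+ n)%g xi)).
Proof.
move=> hh etao xio r; have [y xiy] := boundary_inh xi.
have hV := orbit_gromov_seq o (hyperbolicV o hh).
have [|C [M hC]] := not_asymptotic_bounded o (boundary_gromov xiy) hV.
  by move=> yo; apply: xio; exact: (boundary_mem hypX xiy).
have [K [K0 hK _]] := orbit_gromov_product o hh.
have [N hN] := @archi_mul R _ (r + K + `|C| + delta) hh.
exists (maxn N M) => n Nn; apply/shadow_boundaryP.
exists (orbit_seq h o), (a (h ^+ n)%g \o y); split => //.
  exact: boundary_act_mem.
have d0 := delta_ge0 hypX o.
exists n => i j ni nj.
(* Applying h ^+ n to the triangle of o, h ^- n o and y j turns a small product
   at o into a large one. *)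
have h1 : gromov_product o (a (h ^+ n)%g (y j)) (orbit_seq h o n) =
    mdist (a (h ^+ n)%g o) o - gromov_product o (y j) (orbit_seq h^-1%g o n).
  have := gp_swap o (orbit_seq h^-1%g o n) (y j).
  rewrite -(gromov_product_act a (h ^+ n)%g (orbit_seq h^-1%g o n)).
  rewrite /orbit_seq expVgn actKV (metric_sym o) inv_dist.
  rewrite (gpC o (y j)) (gpC o (a _ (y j))) (gpC _ _ (a _ (y j))); lra.
have h2 := hC j n ltac:(lia) ltac:(lia).
have h3 := hK n n i (leqnn _) ni.
have [lu _] := rate_translation_length a h o; have {lu}h4 := lu n.
have h5 : N%:R * translation_length a h <= n%:R * translation_length a h.
  by apply: ler_wpM2r; [exact: ltW|rewrite ler_nat; lia].
have := gp_min hypX o (orbit_seq h o i) (a (h ^+ n)%g (y j)) (orbit_seq h o n).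
rewrite (gpC o (orbit_seq h o i) (orbit_seq h o n)) /=.
have := ler_norm C; have := normr_ge0 C.
by move=> ? ? [?|?]; lra.
Qed.

(** A fixed point other than the repelling one is attracted to the attracting
    one without moving. *)
Lemma fixed_orbit h o xi : hyperbolic a h -> boundary_fixed a h xi ->
  boundary_seqs xi (orbit_seq h o) \/ boundary_seqs xi (orbit_seq h^-1%g o).
Proof.
move=> hh fx; have [|xio] := pselect (boundary_seqs xi (orbit_seq h^-1%g o)).
  by right.
left; pose eta := boundary_of (orbit_gromov_seq o hh).
have etao : boundary_seqs eta (orbit_seq h o).
  by split; exact: orbit_gromov_seq.
have [y xiy] := boundary_inh xi.
suff -> : xi = eta by [].
apply: (boundary_meet hypX xiy etao); apply: asymptotic_sym.
apply: (@asymptotic_at _ _ o) => r.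
have [N hN] := north_south hh etao xio (r + 2 * delta).
have := hN N (leqnn _).
rewrite (_ : boundary_act a (h ^+ N)%g xi = xi); last exact: boundary_fixedX.
by move=> /shadow_all -/(_ _ hypX _ _ etao xiy); rewrite addrK.
Qed.

(** A common end of the two orbits would be a common fixed point. *)
Lemma independent_bounded g h o : hyperbolic a g -> hyperbolic a h ->
  boundary_fixed a g `&` boundary_fixed a h = set0 ->
  exists C, forall i j,
    gromov_product o (orbit_seq g o i) (orbit_seq h o j) <= C.
Proof.
move=> hg hh gh.
have gg := orbit_gromov_seq o hg; have gh' := orbit_gromov_seq o hh.
have [|C [M hC]] := not_asymptotic_bounded o gg gh'.
  move=> A; have : (boundary_fixed a g `&` boundary_fixed a h) (boundary_of gg).
    by split; [apply: (@orbit_fixed g o)|apply: (@orbit_fixed h o)].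
  by rewrite gh.
pose B k := mdist (a k o) o.
have disp k n : (n <= M)%N -> mdist (orbit_seq k o n) o <= M%:R * B k.
  move=> nM; apply: (@le_trans _ _ (n%:R * B k)); last first.
    by apply: ler_wpM2r; [exact: mdist_ge0|rewrite ler_nat].
  elim: n {nM} => [|n IH]; first by rewrite /orbit_seq act1 mdistxx mul0r.
  have e : orbit_seq k o n.+1 = a k (orbit_seq k o n).
    by rewrite /orbit_seq expgS actM.
  have := metric_triangle (orbit_seq k o n.+1) (a k o) o.
  by rewrite -natr1 e act_isometry -/(B k); lra.
exists (`|C| + M%:R * B g + M%:R * B h) => i j.
have B0 k : 0 <= M%:R * B k by rewrite mulr_ge0 // mdist_ge0.
have [Mi|/ltnW iM] := leqP M i; last first.
  have := gp_le o (orbit_seq g o i) (orbit_seq h o j).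
  by have := disp g i iM; have := B0 h; have := normr_ge0 C; lra.
have [Mj|/ltnW jM] := leqP M j; last first.
  have := gp_le o (orbit_seq h o j) (orbit_seq g o i); rewrite gpC.
  by have := disp h j jM; have := B0 g; have := normr_ge0 C; lra.
have := hC i j Mi Mj; have := ler_norm C; have := B0 g; have := B0 h; lra.
Qed.

End Dynamics.

(** * Non-elementary actions *)

Section NonElementary.
Context {R : realType} {G : groupType} {X : metricType R}.
Variable a : isometric_action G X.
Context {delta : R} (hypX : gromov_hyperbolic X delta).
Implicit Types (g h s t : G) (o x y z : X).

(** Seen from the far end [x] of a broken line, the next turn is still obtuse,
    provided that the segment between the two turns is long enough. *)
Lemma gp_chain (x y z t : X) A :
  gromov_product y x z <= A + delta -> gromov_product z y t <= A ->
  2 * A + 2 * delta < mdist y z -> gromov_product z x t <= A + delta.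
Proof.
move=> h1 h2 h3; have := gp_min hypX z y t x; rewrite (gpC z t x).
by have := gp_swap y z x; rewrite (gpC y z x) (gpC z y x) => ? [|]; lra.
Qed.

(** The broken line [o, g o, g s o, g s t o] and its translate by [g s t] make
    only obtuse turns, so that the displacement of the square of [g s t] exceeds
    that of [g s t] by the length of the extra segments. *)
Lemma translation_length_obtuse g s t o A : 0 <= A ->
  gromov_product o (a g^-1%g o) (a s o) <= A ->
  gromov_product o (a s^-1%g o) (a t o) <= A ->
  gromov_product o (a t^-1%g o) (a g o) <= A ->
  2 * A + 2 * delta < mdist (a g o) o ->
  2 * A + 2 * delta < mdist (a s o) o ->
  2 * A + 2 * delta < mdist (a t o) o ->
  mdist (a g o) o <= translation_length a (g * s * t)%g + (2 * A + 4 * delta).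
Proof.
move=> A0 hgs hst htg lg ls lt; set w := (g * s * t)%g.
have d0 := delta_ge0 hypX o.
have turn k k1 k2 : gromov_product o (a k1^-1%g o) (a k2 o) <= A ->
    gromov_product (a (k * k1)%g o) (a k o) (a (k * k1 * k2)%g o) <= A.
  move=> h; rewrite (_ : a k o = a (k * k1)%g (a k1^-1%g o)).
    by rewrite [a (_ * k2)%g o]actM gromov_product_act.
  by rewrite -actM mulgK.
have len k k1 : mdist (a k o) (a (k * k1)%g o) = mdist (a k1 o) o.
  by rewrite actM act_isometry metric_sym.
have t1 := turn 1%g g s hgs; have t2 := turn g s t hst.
have t3 := turn (g * s)%g t g htg; have t4 := turn w g s hgs.
have t5 := turn (w * g)%g s t hst; rewrite !mul1g act1 in t1.
rewrite -/w in t2 t3.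
have c2 : gromov_product (a (g * s)%g o) o (a w o) <= A + delta.
  by apply: gp_chain t2 _; [lra|rewrite len].
have c3 : gromov_product (a w o) o (a (w * g)%g o) <= A + delta.
  by apply: gp_chain c2 t3 _; rewrite len.
have c4 : gromov_product (a (w * g)%g o) o (a (w * g * s)%g o) <= A + delta.
  by apply: gp_chain c3 t4 _; rewrite len.
have c5 : gromov_product (a (w * g * s)%g o) o (a (w * g * s * t)%g o)
    <= A + delta.
  by apply: gp_chain c4 t5 _; rewrite len.
have := translation_length_jump a hypX w o.
have -> : (w * w = w * g * s * t)%g by rewrite /w !mulgA.
rewrite (metric_sym _ o) (metric_sym (a w o)).
have := gpE (a w o) o (a (w * g)%g o).
have := gpE (a (w * g)%g o) o (a (w * g * s)%g o).
have := gpE (a (w * g * s)%g o) o (a (w * g * s * t)%g o).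
rewrite (metric_sym (a (w * g)%g o) (a w o)) len.
rewrite (metric_sym (a (w * g * s)%g o) (a (w * g)%g o)) len.
rewrite (metric_sym (a (w * g * s * t)%g o) (a (w * g * s)%g o)) len.
lra.
Qed.

(** Of two directions [u o] and [v o] that diverge, [g o] can follow at most
    one; so a bounded correction [s * t] makes [g] translate along a line that
    passes near [o]. *)
Lemma non_elementary_displacement o : non_elementary a -> exists u v C,
  forall g, exists s t, [/\ s = u \/ s = v, t = u \/ t = v &
    mdist (a g o) o <= translation_length a (g * s * t)%g + C].
Proof.
move=> [u [v [hu hv uv]]].
have hu' := hyperbolicV o hu; have hv' := hyperbolicV o hv.
have FV k : boundary_fixed a k = boundary_fixed a k^-1%g.
  apply/seteqP; split=> xi; first exact: boundary_fixedV.
  by move=> /(boundary_fixedV hypX); rewrite invgK.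
have [C1 h1] := independent_bounded hypX o hu hv uv.
have [|C2 h2] := independent_bounded hypX o hu' hv'; first by rewrite -!FV.
have [|C3 h3] := independent_bounded hypX o hu' hv; first by rewrite -FV.
have [|C4 h4] := independent_bounded hypX o hu hv'; first by rewrite -FV.
have [C5 [C50 _ h5]] := orbit_gromov_product hypX o hu.
have [C6 [C60 _ h6]] := orbit_gromov_product hypX o hv.
have d0 := delta_ge0 hypX o.
pose A := `|C1| + `|C2| + `|C3| + `|C4| + C5 + C6 + delta.
have [n1 hn1] := @archi_mul R _ (2 * A + 2 * delta) hu.
have [n2 hn2] := @archi_mul R _ (2 * A + 2 * delta) hv.
pose N := (n1 + n2)%N.
have big k n : (n <= N)%N -> hyperbolic a k ->
    2 * A + 2 * delta < n%:R * translation_length a k ->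
    2 * A + 2 * delta < mdist (a (k ^+ N)%g o) o.
  move=> nN hk h; have [lu _] := rate_translation_length a k o.
  apply: lt_le_trans (lu N); apply: lt_le_trans h _.
  by apply: ler_wpM2r; [exact: ltW|rewrite ler_nat].
have Nu := big u n1 (leq_addr _ _) hu hn1.
have Nv := big v n2 (leq_addl _ _) hv hn2.
have := ler_norm C1; have := normr_ge0 C1; have := ler_norm C2.
have := normr_ge0 C2; have := ler_norm C3; have := normr_ge0 C3.
have := ler_norm C4; have := normr_ge0 C4 => ? ? ? ? ? ? ? ?.
have VE (k : G) : (k ^+ N)^-1%g = (k^-1 ^+ N)%g by rewrite expVgn.
(* A direction p cannot follow both u ^+ N and v ^+ N, nor both inverses. *)
have choice_fwd p : exists s, (s = (u ^+ N)%g \/ s = (v ^+ N)%g) /\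
    gromov_product o p (a s o) <= A.
  have := gp_min hypX o (a (u ^+ N)%g o) (a (v ^+ N)%g o) p.
  have := h1 N N; rewrite /orbit_seq => ? [?|?].
    exists (u ^+ N)%g; split; first by left.
    by rewrite gpC /A; lra.
  exists (v ^+ N)%g; split; first by right.
  by rewrite gpC /A; lra.
have choice_bwd p : exists s, (s = (u ^+ N)%g \/ s = (v ^+ N)%g) /\
    gromov_product o (a s^-1%g o) p <= A.
  have := gp_min hypX o (a (u ^+ N)^-1%g o) (a (v ^+ N)^-1%g o) p.
  have := h2 N N; rewrite /orbit_seq !VE => ? [?|?].
    exists (u ^+ N)%g; split; first by left.
    by rewrite VE /A; lra.
  exists (v ^+ N)%g; split; first by right.
  by rewrite VE /A; lra.
exists (u ^+ N)%g, (v ^+ N)%g, (2 * A + 4 * delta) => g.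
have [s [hs gs]] := choice_fwd (a g^-1%g o).
have [t [ht tg]] := choice_bwd (a g o).
exists s, t; split => //.
have [small|large] := leP (mdist (a g o) o) (2 * A + 2 * delta).
  by have := translation_length_ge0 a (g * s * t)%g o; lra.
apply: translation_length_obtuse => //; first by rewrite /A; lra.
- move: hs ht => [->|->] [->|->]; rewrite VE.
  + by have := h5 N N; rewrite gpC /orbit_seq /A; lra.
  + by have := h3 N N; rewrite /orbit_seq /A; lra.
  + by have := h4 N N; rewrite gpC /orbit_seq /A; lra.
  + by have := h6 N N; rewrite gpC /orbit_seq /A; lra.
- by case: hs => ->.
- by case: ht => ->.
Qed.

End NonElementary.

Section NonElementaryComparison.
Context {R : realType} {G : groupType} {X Y : metricType R}.
Variables (aX : isometric_action G X) (aY : isometric_action G Y).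

Definition orbits_dominated (o : X) (o' : Y) :=
  exists C, forall g, mdist (aX g o) o <= mdist (aY g o') o' + C.

(** Translation lengths are bounded by displacements on the other side, and the
    correction [s * t] ranges over a finite set. *)
Lemma non_elementary_dominated delta (o : X) (o' : Y) :
  gromov_hyperbolic X delta -> non_elementary aX ->
  translation_length aX = translation_length aY -> orbits_dominated o o'.
Proof.
move=> hypX ne lXY; have [u [v [C hC]]] := non_elementary_displacement hypX o ne.
pose B := mdist (aY u o') o' + mdist (aY v o') o'.
exists (C + 2 * B) => g; have [s [t [hs ht h]]] := hC g.
have b k : k = u \/ k = v -> mdist (aY k o') o' <= B.
  have := mdist_ge0 (aY u o') o'; have := mdist_ge0 (aY v o') o'.
  by move=> ? ? [->|->]; rewrite /B; lra.
have := b _ hs; have := b _ ht.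
have := translation_length_le aY (g * s * t)%g o'; rewrite -lXY.
have := metric_triangle (aY (g * s * t)%g o') (aY g o') o'.
have := metric_triangle (aY s (aY t o')) (aY s o') o'.
by rewrite -mulgA actM act_isometry actM act_isometry mulgA; move: h; lra.
Qed.

End NonElementaryComparison.

(** * Hulls of orbits *)

Definition hull_covers {R : realType} {A : Type} {X : metricType R}
    (i : A -> X) (C : R) :=
  forall p, exists k l, gromov_product p (i k) (i l) <= C.

Section OrbitHull.
Context {R : realType} {G : groupType} {X : metricType R}.
Variable a : isometric_action G X.
Context {delta : R} (hypX : gromov_hyperbolic X delta).
Implicit Types (g h : G) (o p q : X) (xi : boundary X).

Lemma limit_set_gp xi x p o r : limit_set a xi -> boundary_seqs xi x ->
  exists g, gp_eventually p x (cst (a g o)) r.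
Proof.
move=> [q qxi] xix; pose r' := r + mdist q o + delta.
have [_ [[g _ <-] sh]] := qxi _ (nbhs_shadow hypX p xi r').
exists g; have [N hN] := shadow_inside_all hypX sh xix.
exists N => i j Ni Nj; have := hN i j Ni Nj; rewrite /cst.
have := gp_lipl p (a g q) (a g o) (x i); rewrite act_isometry /r'.
by rewrite !(gpC p _ (x i)); lra.
Qed.

Lemma ray_gp (c : R^o -> X) xi x p r :
  Inside (c t) @[t --> +oo] --> AtInfinity xi -> boundary_seqs xi x ->
  exists T, forall t, T < t -> gp_eventually p x (cst (c t)) r.
Proof.
move=> cv xix; have [T [_ hT]] := cv _ (nbhs_shadow hypX p xi (r + delta)).
exists T => t Tt; have := shadow_inside_all hypX (hT t Tt) xix.
by rewrite addrK.
Qed.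

(** A ray through [q] and then [p] makes no turn at [p], and near its end there
    are points of the orbit of [o]. *)
Lemma extend_beyond K (c : R^o -> X) xi s t p q o :
  limit_set a xi -> rough_ray_to K c xi ->
  0 <= s -> s <= t -> c s = q -> c t = p ->
  exists g, gromov_product p q (a g o) <= 3 * K / 2 + delta.
Proof.
move=> lxi [geo cv] s0 st cs ct; have [x xix] := boundary_inh xi.
pose r := 3 * K / 2 + 3 * delta + 1.
have [T hT] := ray_gp p r cv xix.
have [g hg] := limit_set_gp p o r lxi xix.
have t0 : 0 <= t by exact: le_trans st.
pose T' := Num.max T t + 1.
have tm : t <= Num.max T t by rewrite le_max lexx orbT.
have Tm : T <= Num.max T t by rewrite le_max lexx.
have tT' : t <= T' by rewrite /T'; lra.
have TT' : T < T' by rewrite /T'; lra.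
have mem y : 0 <= y -> ([set` `[0, +oo[] : set R^o) y.
  by move=> y0; rewrite /= in_itv /= y0.
have T'0 : 0 <= T' by exact: le_trans tT'.
have d1 := geo s t (mem _ s0) (mem _ t0).
have d2 := geo t T' (mem _ t0) (mem _ T'0).
have d3 := geo s T' (mem _ s0) (mem _ T'0).
have md (y z : R) : y <= z -> mdist (y : R^o) z = z - y.
  by move=> yz; rewrite /mdist /= ger0_norm // subr_ge0.
rewrite cs ct in d1 d2 d3; move: d1 d2 d3.
rewrite !md //; last exact: le_trans tT'.
rewrite !ler_norml => /andP[_ d1] /andP[_ d2] /andP[d3 _].
have h1 : gromov_product p q (c T') <= 3 * K / 2.
  by have := gpE p q (c T'); rewrite (metric_sym (c T')); lra.
have [N hN] := gp_eventually_trans hypX (gp_eventually_sym (hT _ TT')) hg.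
have h2 := hN N N (leqnn _) (leqnn _); rewrite /cst in h2.
exists g; have := gp_min hypX p q (c T') (a g o).
have d0 := delta_ge0 hypX o.
by move: h2; rewrite /r => h2 [|]; lra.
Qed.

(** Every point [p] is near a geodesic between two orbit points: rough
    completeness, applied to [p] and a far translate [g p], extends one of the
    two beyond the other, and moving the picture by [g^-1] exchanges their roles. *)
Lemma orbit_hull K o : roughly_complete X K -> limit_set a = setT ->
  (exists g, hyperbolic a g) ->
  exists C, hull_covers (a ^~ o) C.
Proof.
move=> cX lT [g hg]; pose C := 3 * K / 2 + delta.
exists (C + delta) => p.
have lim xi : limit_set a xi by rewrite lT.
have [n hn] := @archi_mul R _ (mdist o p + C + delta) hg.
have far : mdist o p + C + delta < mdist (a (g ^+ n)%g p) p.
  have [lu _] := rate_translation_length a g p.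
  exact: lt_le_trans hn (lu n).
(* The translate of p is so far that the translate of o lies in the same
   direction. *)
have replace f z : mdist o p + C + delta < mdist (a f p) p ->
    gromov_product p (a f p) z <= C -> gromov_product p (a f o) z <= C + delta.
  move=> ff h; have := gp_min hypX p (a f p) z (a f o).
  have := gpE p (a f p) (a f o); have := metric_triangle (a f p) (a f o) p.
  by rewrite act_isometry (metric_sym p o) (gpC p z) => ? ? [|]; lra.
have [c [xi [ray [s [t [s0 t0 cs ct]]]]]] := cX (a (g ^+ n)%g p) p.
have [st|/ltW ts] := leP s t.
  have [h hh] := extend_beyond o (lim _) ray s0 st cs ct.
  by exists (g ^+ n)%g, h; exact: replace.
have [h hh] := extend_beyond o (lim _) ray t0 ts ct cs.
exists (g ^+ n)^-1%g, ((g ^+ n)^-1 * h)%g; apply: replace.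
  by rewrite inv_dist.
by rewrite actM -(gromov_product_act a (g ^+ n)%g) !actKV.
Qed.

End OrbitHull.

(** * Extending a comparison of orbits *)

Section Extension.
Context {R : realType} {A : Type}.

(** Distances to a family serve as coordinates of a point: if hulls cover the
    spaces, matched points determine each other up to a bounded error. *)
Definition matched {X Y : metricType R} (i : A -> X) (j : A -> Y) E p p' :=
  forall k, `|mdist p (i k) - mdist p' (j k)| <= E.

Lemma matched_sym {X Y : metricType R} (i : A -> X) (j : A -> Y) E p p' :
  matched i j E p p' -> matched j i E p' p.
Proof. by move=> h k; rewrite distrC. Qed.

Lemma point_between {X : metricType R} K (x y : X) r :
  0 <= K -> roughly_geodesic X K -> 0 <= r -> r <= mdist x y ->
  exists z, `|mdist z x - r| <= 2 * K /\
            `|mdist z y - (mdist x y - r)| <= 2 * K.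
Proof.
move=> K0 gX r0 rxy; have [u [v [c [uv geo cu cv]]]] := gX x y.
have mem t : u <= t -> t <= v -> ([set` `[u, v]] : set R^o) t.
  by move=> ut tv; rewrite /= in_itv /= ut tv.
have md (s t : R) : s <= t -> mdist (s : R^o) t = t - s.
  by move=> st; rewrite /mdist /= ger0_norm // subr_ge0.
have := geo u v (mem _ (lexx _) uv) (mem _ uv (lexx _)).
rewrite cu cv md // ler_norml => /andP[h1 h2].
have [rv|vr] := leP (u + r) v.
  have ur : u <= u + r by lra.
  have := geo u (u + r) (mem _ (lexx _) uv) (mem _ ur rv).
  have := geo (u + r) v (mem _ ur rv) (mem _ uv (lexx _)).
  rewrite cu cv !md // !ler_norml => /andP[h3 h4] /andP[h5 h6].
  exists (c (u + r)); rewrite (metric_sym (c _) x) !ler_norml.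
  by split; apply/andP; split; lra.
exists y; rewrite mdistxx (metric_sym y x) !ler_norml.
by split; apply/andP; split; lra.
Qed.

(** A point near a geodesic from [x] to [y] realises, up to a constant, one of
    the two triangle inequalities from [z]. *)
Lemma dist_between {X : metricType R} delta C (p x y z : X) :
  gromov_hyperbolic X delta -> gromov_product p x y <= C ->
  mdist z p <= mdist z x - mdist p x + 2 * delta + 2 * C \/
  mdist z p <= mdist z y - mdist p y + 2 * delta + 2 * C.
Proof.
move=> hypX h; have := gpE p x y; rewrite (metric_sym x p) (metric_sym y p).
have := four_point hypX z p x y; rewrite (metric_sym p x).
by move=> [|]; [left|right]; lra.
Qed.

(** Both triangle inequalities of [dist_between], for [q] between two members of
    the family, are expressed by distances that agree on the two sides. *)
Lemma matched_le {X Y : metricType R} (i : A -> X) (j : A -> Y) (delta C E : R)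
    p q p' q' :
  gromov_hyperbolic X delta -> hull_covers i C ->
  matched i j E p p' -> matched i j E q q' ->
  mdist p q <= mdist p' q' + (2 * E + 2 * delta + 2 * C).
Proof.
move=> hypX hull pp' qq'; have [k [l kl]] := hull q.
have := pp' k; have := pp' l; have := qq' k; have := qq' l.
rewrite !ler_norml => /andP[? ?] /andP[? ?] /andP[? ?] /andP[? ?].
have := metric_triangle p' q' (j k); have := metric_triangle p' q' (j l).
by have [|] := dist_between p hypX kl; lra.
Qed.

(** Put [p] between two members of the first family and take the point at the
    same distance from one end between their counterparts; by [dist_between] the
    other distances follow. *)
Lemma matched_exists {X Y : metricType R} (i : A -> X) (j : A -> Y)
    (dX dY C C0 K : R) :
  gromov_hyperbolic X dX -> gromov_hyperbolic Y dY ->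
  0 <= K -> roughly_geodesic Y K -> hull_covers i C ->
  (forall k l, `|mdist (i k) (i l) - mdist (j k) (j l)| <= C0) ->
  exists E, forall p, exists p', matched i j E p p'.
Proof.
move=> hypX hypY K0 gY hull ij.
exists (8 * `|C| + 8 * `|C0| + 8 * K + 2 * `|dX| + 2 * `|dY|) => p.
have [k [l kl]] := hull p.
have := ij k l; rewrite ler_norml => /andP[e1 e2].
have := gpE p (i k) (i l); rewrite (metric_sym (i k) p) (metric_sym (i l) p).
move=> pkl.
have t1 := metric_triangle (i k) p (i l); rewrite (metric_sym (i k) p) in t1.
have n1 := ler_norm C; have n2 := ler_norm C0; have n3 := ler_norm dX.
have n4 := ler_norm dY; have p1 := normr_ge0 C; have p2 := normr_ge0 C0.
have p3 := normr_ge0 dX; have p4 := normr_ge0 dY.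
(* The minimum with D matters only up to the bounded difference between the
   lengths of the two segments. *)
pose D := mdist (j k) (j l); pose r := Num.min (mdist p (i k)) D.
have r0 : 0 <= r by rewrite /r le_min !mdist_ge0.
have rD : r <= D by rewrite /r ge_min lexx orbT.
have rp : `|r - mdist p (i k)| <= 2 * `|C| + `|C0|.
  rewrite /r minEle /D; case: ifP => [_|/negbT].
    by rewrite subrr normr0; lra.
  have := mdist_ge0 p (i l).
  by rewrite -ltNge ler_norml => ? ?; apply/andP; split; lra.
have [p' []] := point_between K0 gY r0 rD; rewrite -/D.
move: rp; rewrite !ler_norml => /andP[r1 r2] /andP[r3 r4] /andP[r5 r6].
exists p' => m; have := ij m k; have := ij m l.
rewrite !ler_norml => /andP[m1 m2] /andP[m3 m4].
have between' : gromov_product p' (j k) (j l) <= 2 * K.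
  have := gpE p' (j k) (j l).
  by rewrite (metric_sym (j k) p') (metric_sym (j l) p') -/D; lra.
have := metric_triangle (i m) p (i k); have := metric_triangle (i m) p (i l).
have := metric_triangle (j m) p' (j k); have := metric_triangle (j m) p' (j l).
have := dist_between (i m) hypX kl; have := dist_between (j m) hypY between'.
rewrite !(metric_sym p (i m)) !(metric_sym p' (j m)) /D in r3 r4 r5 r6 *.
by move=> [?|?] [?|?] ? ? ? ?; apply/andP; split; lra.
Qed.

End Extension.

Section OrbitExtension.
Context {R : realType} {G : groupType} {X Y : metricType R}.
Variables (aX : isometric_action G X) (aY : isometric_action G Y).

(** A point is determined, up to a bounded error, by its distances to a family
    whose hull is the whole space. Sending [p] to a point with the same
    distances to the orbit of [o'] as [p] has to the orbit of [o] therefore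
    gives the required map, and each of its properties is an instance of this
    uniqueness. *)
Lemma extend_orbit_map (dX dY KX KY CX CY C0 : R) (o : X) (o' : Y) :
  gromov_hyperbolic X dX -> gromov_hyperbolic Y dY ->
  0 <= KX -> 0 <= KY -> roughly_geodesic X KX -> roughly_geodesic Y KY ->
  hull_covers (aX ^~ o) CX -> hull_covers (aY ^~ o') CY ->
  (forall g, `|mdist (aX g o) o - mdist (aY g o') o'| <= C0) ->
  exists (phi : X -> Y) (C : R),
    [/\ 0 < C, roughly_equivariant aX aY phi, rough_isometry C phi &
        forall p q : X, `|mdist (phi p) (phi q) - mdist p q| < C].
Proof.
move=> hypX hypY KX0 KY0 gX gY hX hY orb.
pose i g := aX g o; pose j g := aY g o'.
have ij k l : `|mdist (i k) (i l) - mdist (j k) (j l)| <= C0.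
  have := orb (l^-1 * k)%g; rewrite /i /j !actM !actV_dist.
  by rewrite !(metric_sym (_ _ k _)).
have ji k l : `|mdist (j k) (j l) - mdist (i k) (i l)| <= C0 by rewrite distrC.
have [EX hEX] := matched_exists hypX hypY KY0 gY hX ij.
have [EY hEY] := matched_exists hypY hypX KX0 gX hY ji.
pose E := Num.max EX EY.
have mon EE p p' : EE <= E -> matched i j EE p p' -> matched i j E p p'.
  by move=> le h k; apply: le_trans le.
have leX : EX <= E by rewrite le_max lexx.
have leY : EY <= E by rewrite le_max lexx orbT.
have hE p : exists p', matched i j E p p'.
  by have [p' hp'] := hEX p; exists p'; exact: mon hp'.
have [phi hphi] := choice hE.
pose C := 2 * E + 2 * `|dX| + 2 * `|dY| + 2 * `|CX| + 2 * `|CY|.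
have n1 := ler_norm CX; have n2 := ler_norm CY; have n3 := ler_norm dX.
have n4 := ler_norm dY; have p1 := normr_ge0 CX; have p2 := normr_ge0 CY.
have p3 := normr_ge0 dX; have p4 := normr_ge0 dY.
have close p q p' q' : matched i j E p p' -> matched i j E q q' ->
    `|mdist p' q' - mdist p q| <= C.
  move=> mp mq; have := matched_le hypX hX mp mq.
  have := matched_le hypY hY (matched_sym mp) (matched_sym mq).
  by rewrite ler_norml /C => ? ?; apply/andP; split; lra.
have unique p p' p'' : matched i j E p p' -> matched i j E p p'' ->
    mdist p' p'' <= C.
  move=> m1 m2; have := close _ _ _ _ m1 m2.
  by rewrite mdistxx subr0 ger0_norm // mdist_ge0.
have C0' : 0 <= C.
  exact: le_trans (mdist_ge0 _ _) (unique o _ _ (hphi o) (hphi o)).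
exists phi, (C + 1); split; first lra.
- exists C => g p; apply: (unique (aX g p)) => // k.
  have := hphi p (g^-1 * k)%g; rewrite /i /j !actM.
  rewrite -(act_isometry aX g) actKV.
  by rewrite -(act_isometry aY g (phi p)) actKV.
- split=> [p q _ _|]; first by have := close _ _ _ _ (hphi p) (hphi q); lra.
  exists C => y; have [x hx] := hEY y; exists x; apply: (unique x) => //.
  by apply: mon leY _; exact: matched_sym.
- by move=> p q; have := close _ _ _ _ (hphi p) (hphi q); lra.
Qed.

End OrbitExtension.

(** * Actions that fix a point at infinity *)

Section Busemann.
Context {R : realType} {G : groupType} {X : metricType R}.
Variable a : isometric_action G X.
Context {delta : R} (hypX : gromov_hyperbolic X delta).
Implicit Types (g h : G) (o p q r : X) (b : X -> R).

(** The other case of the four-point condition would bound the Gromov products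
    of the two sequences. *)
Lemma busemann_cocycle_close (z z' : nat -> X) p q : asymptotic z z' ->
  exists N, forall n m, (N <= n)%N -> (N <= m)%N ->
    mdist p (z n) - mdist q (z n) <=
    mdist p (z' m) - mdist q (z' m) + 2 * delta.
Proof.
move=> /asymptoticP/(_ p (mdist p q + delta + 1)) [N hN]; exists N => n m Nn Nm.
have := hN n m Nn Nm; have := gpE p (z n) (z' m).
rewrite (metric_sym (z n) p) (metric_sym (z' m) p).
have := metric_triangle p q (z' m).
have := four_point hypX p (z n) q (z' m).
by rewrite (metric_sym (z n) q) => -[|]; lra.
Qed.

(** A horofunction centred at [omega]: every sequence that represents [omega]
    computes it up to a multiple of [delta]. *)
Definition busemann (omega : boundary X) o b :=
  forall z, boundary_seqs omega z -> forall p, exists N, forall n, (N <= n)%N ->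
    `|mdist p (z n) - mdist o (z n) - b p| <= 4 * delta.

Lemma busemann_exists omega o : exists b, busemann omega o b.
Proof.
have [z0 oz0] := boundary_inh omega.
have hN p : exists N, forall n m, (N <= n)%N -> (N <= m)%N ->
    mdist p (z0 n) - mdist o (z0 n) <=
    mdist p (z0 m) - mdist o (z0 m) + 2 * delta.
  exact: (busemann_cocycle_close p o (boundary_gromov oz0)).
have [N {}hN] := choice hN.
exists (fun p => mdist p (z0 (N p)) - mdist o (z0 (N p))) => z oz p.
have A := boundary_asymptotic hypX oz oz0.
have [N1 h1] := busemann_cocycle_close p o A.
have [N2 h2] := busemann_cocycle_close p o (asymptotic_sym A).
pose M := maxn (N p) (maxn N1 N2); exists M => n Mn.
have := h1 n M ltac:(lia) ltac:(lia); have := h2 M n ltac:(lia) ltac:(lia).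
have := hN p M (N p) ltac:(lia) (leqnn _).
have := hN p (N p) M (leqnn _) ltac:(lia).
by rewrite ler_norml => ? ? ? ?; apply/andP; split; lra.
Qed.

(** For a horofunction [b], up to a bounded error, the Gromov product of [p] and
    [q] at a point [z] near the centre of [b], minus the distance from [z] to the
    base point of [b]. *)
Definition horo_product b p q : R := (b p + b q - mdist p q) / 2.

Lemma horo_productE b p q : 2 * horo_product b p q = b p + b q - mdist p q.
Proof. by rewrite /horo_product; lra. Qed.

Lemma horo_productC b p q : horo_product b p q = horo_product b q p.
Proof. by rewrite /horo_product metric_sym [b p + _]addrC. Qed.

Lemma gp_horo b o p q : gromov_product o p q =
  horo_product b p q - horo_product b p o - horo_product b q o + b o.
Proof.
have := gpE o p q; have := horo_productE b p q; have := horo_productE b p o.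
have := horo_productE b q o; lra.
Qed.

(** All that is used of a horofunction [b] whose centre is fixed by the whole
    group and is the repelling point of [h]. One constant [E] bounds all errors,
    so that later estimates are linear in [E]. *)
Record focal h o b (E : R) : Prop := Focal {
  focal_base : `|b o| <= E ;
  focal_act : forall g p, `|b (a g p) - b (a g o) - b p| <= E ;
  focal_min : forall p q r, horo_product b p r <= horo_product b p q + E \/
    horo_product b r q <= horo_product b p q + E ;
  focal_le : forall p q, horo_product b p q <= b p + E ;
  focal_fwd : forall n,
    `|b (a (h ^+ n)%g o) - n%:R * translation_length a h| <= E ;
  focal_bwd : forall n,
    `|b (a (h^-1 ^+ n)%g o) + n%:R * translation_length a h| <= E ;
  focal_dist : forall n,
    `|mdist (a (h ^+ n)%g o) o - n%:R * translation_length a h| <= E }.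

Lemma focal_exists h o omega : hyperbolic a h ->
  (forall g, boundary_fixed a g omega) ->
  boundary_seqs omega (orbit_seq a h^-1%g o) -> exists b E, focal h o b E.
Proof.
move=> hh fx omegah; have [b hb] := busemann_exists omega o.
have [K [K0 lu ul]] := hyperbolic_axis hypX o hh.
have d0 := delta_ge0 hypX o.
have bz := hb _ omegah; set z := orbit_seq _ _ _ in bz.
have zact g : boundary_seqs omega (a g \o z).
  by rewrite -(fx g); exact: boundary_act_mem.
exists b, (16 * delta + K); split.
- have [N /(_ N (leqnn _))] := bz o.
  by rewrite subrr sub0r normrN; lra.
- move=> g p; have [N1 h1] := hb _ (zact g) (a g p).
  have [N2 h2] := hb _ (zact g) (a g o); have [N3 h3] := bz p.
  pose n := maxn N1 (maxn N2 N3).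
  have := h1 n ltac:(lia); have := h2 n ltac:(lia); have := h3 n ltac:(lia).
  rewrite /= !act_isometry !ler_norml => /andP[? ?] /andP[? ?] /andP[? ?].
  by apply/andP; split; lra.
- move=> p q r; have [N1 h1] := bz p; have [N2 h2] := bz q.
  have [N3 h3] := bz r; pose n := maxn N1 (maxn N2 N3).
  have := h1 n ltac:(lia); have := h2 n ltac:(lia); have := h3 n ltac:(lia).
  rewrite !ler_norml => /andP[? ?] /andP[? ?] /andP[? ?].
  have := horo_productE b p r; have := horo_productE b p q.
  have := horo_productE b r q; have := gpE (z n) p r; have := gpE (z n) p q.
  have := gpE (z n) q r; rewrite (metric_sym q r).
  by have := gp_min hypX (z n) p q r => -[|]; [left|right]; lra.
- move=> p q; have [N1 h1] := bz p; have [N2 h2] := bz q.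
  pose n := maxn N1 N2.
  have := h1 n ltac:(lia); have := h2 n ltac:(lia).
  rewrite !ler_norml => /andP[? ?] /andP[? ?].
  have := horo_productE b p q; have := metric_triangle q p (z n).
  by rewrite (metric_sym q p); lra.
- move=> n; have [N hN] := bz (a (h ^+ n)%g o); have := hN N (leqnn _).
  rewrite /z /orbit_seq orbit_distV (metric_sym o) expVgn inv_dist.
  have := lu (n + N)%N; have := ul (n + N)%N; have := lu N; have := ul N.
  rewrite natrD mulrDl !ler_norml => ? ? ? ? /andP[? ?].
  by apply/andP; split; lra.
- move=> n; have [N hN] := bz (a (h^-1 ^+ n)%g o).
  have := hN (n + N)%N (leq_addl _ _).
  rewrite /z /orbit_seq orbit_dist (metric_sym o) !expVgn !inv_dist.
  have := lu (n + N)%N; have := ul (n + N)%N; have := lu N; have := ul N.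
  rewrite natrD mulrDl !ler_norml => ? ? ? ? /andP[? ?].
  by apply/andP; split; lra.
- move=> n; have := lu n; have := ul n.
  by rewrite ler_norml => ? ?; apply/andP; split; lra.
Qed.

Section FocalTheory.
Context {h : G} {o : X} {b : X -> R} {E : R}.
Hypothesis fb : focal h o b E.
Local Notation hp := (horo_product b).
Local Notation l := (translation_length a h).

Lemma focal_E0 : 0 <= E.
Proof. exact: le_trans (normr_ge0 _) (focal_base fb). Qed.

Lemma focal_horo_act g p q :
  `|hp (a g p) (a g q) - hp p q - b (a g o)| <= E.
Proof.
have := focal_act fb g p; have := focal_act fb g q.
have := horo_productE b (a g p) (a g q); have := horo_productE b p q.
rewrite act_isometry !ler_norml => ? ? /andP[? ?] /andP[? ?].
by apply/andP; split; lra.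
Qed.

Lemma focal_horo_le p : hp p o <= 2 * E.
Proof.
have := focal_le fb o p; have := focal_base fb.
by rewrite horo_productC ler_norml => /andP[]; lra.
Qed.

Lemma focal_le_dist p : b p <= mdist p o + 5 * E.
Proof.
have := focal_horo_le p; have := horo_productE b p o; have := focal_base fb.
by rewrite ler_norml => /andP[]; lra.
Qed.

Lemma focal_horo_fwd n : `|hp (a (h ^+ n)%g o) o| <= 2 * E.
Proof.
have := focal_base fb; have := focal_fwd fb n; have := focal_dist fb n.
have := horo_productE b (a (h ^+ n)%g o) o.
rewrite !ler_norml => ? /andP[? ?] /andP[? ?] /andP[? ?].
by apply/andP; split; lra.
Qed.

(** Up to constants, the heights of the points [g^n o] add up, and a height is at
    most the distance to [o]. *)
Lemma focal_translation_ge g : b (a g o) - E <= translation_length a g.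
Proof.
apply: (@translation_length_ge _ _ _ a g o _ (6 * E)) => n.
have E0 := focal_E0.
suff : n%:R * (b (a g o) - E) - E <= b (a (g ^+ n)%g o).
  by have := focal_le_dist (a (g ^+ n)%g o); lra.
elim: n => [|n IH].
  by rewrite mul0r act1; have := focal_base fb; rewrite ler_norml => /andP[]; lra.
rewrite -natr1 expgS actM; have := focal_act fb g (a (g ^+ n)%g o).
by rewrite ler_norml => /andP[]; lra.
Qed.

(** Far towards the centre, the points [h^-n o] and [g h^-n o] nearly lie on
    a common line to the centre, at a difference of height [b (g o)]. *)
Lemma focal_translation_le g : hyperbolic a h ->
  0 <= b (a g o) -> translation_length a g <= b (a g o) + 12 * E.
Proof.
move=> hh bg0; have E0 := focal_E0.
have [n hn] := @archi_mul R _ (b (a g o) - hp o (a g o)) hh.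
set y := a (h^-1 ^+ n)%g o.
have h1 : `|b y + n%:R * l| <= E := focal_bwd fb n.
have h2 : `|mdist y o - n%:R * l| <= E.
  by rewrite /y expVgn inv_dist; exact: (focal_dist fb n).
have h3 := focal_horo_act g o y; have h4 := focal_act fb g y.
have h5 := focal_min fb o (a g y) (a g o).
have h6 := focal_min fb y (a g y) o.
have h7 := horo_productE b y o; have h8 := horo_productE b y (a g y).
have h9 := focal_base fb; have := translation_length_le a g y.
rewrite (metric_sym _ y).
rewrite (horo_productC b o y) in h3.
move: h1 h2 h3 h4 h9; rewrite !ler_norml.
move=> /andP[? ?] /andP[? ?] /andP[? ?] /andP[? ?] /andP[? ?].
by case: h5; case: h6; lra.
Qed.

(** The points [g h^i o] and [h^j o] prolong lines that come from the centre
    through [g o] and [o], so they diverge no earlier than [g o] and [o]. *)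
Lemma focal_horo_orbit g i j :
  hp (a g o) o - 6 * E <= hp (a g (a (h ^+ i)%g o)) (a (h ^+ j)%g o).
Proof.
have E0 := focal_E0; set xi := a (h ^+ i)%g o; set xj := a (h ^+ j)%g o.
have h1 : `|hp xi o| <= 2 * E := focal_horo_fwd i.
have h2 : `|hp xj o| <= 2 * E := focal_horo_fwd j.
have h3 := focal_horo_act g xi o.
have h4 := focal_min fb (a g xi) o (a g o).
have h5 := focal_min fb (a g xi) xj o.
have h6 := focal_le fb (a g o) o; have h7 := focal_horo_le (a g o).
rewrite (horo_productC b o xj) in h5.
move: h1 h2 h3; rewrite !ler_norml.
move=> /andP[? ?] /andP[? ?] /andP[? ?].
by case: h4; case: h5; lra.
Qed.

(** Conversely, the prolonged lines diverge no later than [g o] and [o], unless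
    one of these two comes first. *)
Lemma focal_horo_orbit_rev g i j M :
  M <= hp (a g (a (h ^+ i)%g o)) (a (h ^+ j)%g o) -> M <= b (a g o) ->
  M <= 0 -> M - 6 * E <= hp (a g o) o.
Proof.
have E0 := focal_E0; set xi := a (h ^+ i)%g o; set xj := a (h ^+ j)%g o.
have h1 : `|hp xi o| <= 2 * E := focal_horo_fwd i.
have h2 : `|hp xj o| <= 2 * E := focal_horo_fwd j.
have h3 := focal_horo_act g xi o.
have h4 := focal_min fb (a g o) xj (a g xi).
have h5 := focal_min fb (a g o) o xj.
rewrite (horo_productC b (a g o) (a g xi)) in h4.
move: h1 h2 h3; rewrite !ler_norml.
move=> /andP[? ?] /andP[? ?] /andP[? ?] ? ? ?.
by case: h4; case: h5; lra.
Qed.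

Lemma focal_displacement g :
  `|mdist (a g o) o - (b (a g o) - 2 * hp (a g o) o)| <= E.
Proof.
have := horo_productE b (a g o) o; have := focal_base fb.
by rewrite !ler_norml => /andP[? ?] ?; apply/andP; split; lra.
Qed.

(** By [gp_horo], the products at [o] and at the centre differ by two products
    with [o]: one is bounded above, the other is small on the line [h^n o]. *)
Lemma focal_gp_ge p n :
  hp p (a (h ^+ n)%g o) - 6 * E <= gromov_product o p (a (h ^+ n)%g o).
Proof.
have E0 := focal_E0; have := gp_horo b o p (a (h ^+ n)%g o).
have := focal_horo_fwd n; have := focal_horo_le p; have := focal_base fb.
by rewrite !ler_norml => /andP[? ?] ? /andP[? ?]; lra.
Qed.

(** If [p] left the line before [o], its Gromov product at [o] with a point of
    the line would be bounded. *)
Lemma focal_gp_rev p n : 9 * E + 1 <= gromov_product o p (a (h ^+ n)%g o) ->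
  - E <= hp p (a (h ^+ n)%g o).
Proof.
have E0 := focal_E0; have := gp_horo b o p (a (h ^+ n)%g o).
have := focal_horo_fwd n; have := focal_base fb.
have := focal_min fb p o (a (h ^+ n)%g o).
rewrite !ler_norml (horo_productC b (a (h ^+ n)%g o) o).
rewrite (horo_productC b o (a (h ^+ n)%g o)).
by move=> [|] ? /andP[? ?] /andP[? ?]; lra.
Qed.

End FocalTheory.
End Busemann.

Section FocalComparison.
Context {R : realType} {G : groupType} {X Y : metricType R}.
Variables (aX : isometric_action G X) (aY : isometric_action G Y).
Context {h : G} {o : X} {o' : Y} {bX : X -> R} {bY : Y -> R} {EX EY : R}.
Hypothesis fX : focal aX h o bX EX.
Hypothesis fY : focal aY h o' bY EY.
Hypothesis same_lengths : translation_length aX = translation_length aY.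
Hypothesis hh : hyperbolic aX h.

(** Up to a constant, [b (g o)] is the translation length of [g h^m] minus that
    of [h^m] for large [m]: multiplying by [h^m] settles the sign. *)
Lemma focal_busemann_le : exists C, forall g, bX (aX g o) <= bY (aY g o') + C.
Proof.
exists (4 * EX + 20 * EY) => g.
have [m hm] := @archi_mul R _ (2 * EY - bY (aY g o')) hh.
have hhY : hyperbolic aY h by rewrite /hyperbolic -same_lengths.
have := focal_act fX g (aX (h ^+ m)%g o).
have := focal_act fY g (aY (h ^+ m)%g o').
have := focal_fwd fX m; have := focal_fwd fY m.
have := focal_translation_ge fX (g * h ^+ m)%g.
have := focal_translation_le fY (g := (g * h ^+ m)%g) hhY.
have := focal_E0 fX; have := focal_E0 fY.
rewrite !actM -same_lengths !ler_norml.
move=> ? ? hY hX /andP[? ?] /andP[? ?] /andP[? ?] /andP[? ?].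
by have := hY ltac:(lra); lra.
Qed.

End FocalComparison.

Section FocalDomination.
Context {R : realType} {G : groupType} {X Y : metricType R}.
Variables (aX : isometric_action G X) (aY : isometric_action G Y).
Context {h : G} {o : X} {o' : Y} {bX : X -> R} {bY : Y -> R} {EX EY : R}.
Hypothesis fX : focal aX h o bX EX.
Hypothesis fY : focal aY h o' bY EY.
Hypothesis same_lengths : translation_length aX = translation_length aY.
Hypothesis hh : hyperbolic aX h.

(** Continuity at the attracting point of [h] at a single scale suffices: the
    powers of [h] bring any element [g] to that scale, and the same power acts
    by the same amount on both sides. *)
Lemma focal_dominated :
  (forall r, exists s, forall g,
    gp_eventually o (aX g \o orbit_seq aX h o) (orbit_seq aX h o) s ->
    gp_eventually o' (aY g \o orbit_seq aY h o') (orbit_seq aY h o') r) ->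
  orbits_dominated aY aX o' o.
Proof.
move=> cont; have [s hs] := cont (9 * EY + 1).
have hhY : hyperbolic aY h by rewrite /hyperbolic -same_lengths.
have [C1 hC1] := focal_busemann_le fX fY same_lengths hh.
have [C2 hC2] := focal_busemann_le fY fX (esym same_lengths) hhY.
have EX0 := focal_E0 fX; have EY0 := focal_E0 fY.
set l := translation_length aX h in hs *.
have l0 : 0 < l := hh.
have n1 := ler_norm s; have n2 := ler_norm C1; have n3 := ler_norm C2.
have p1 := normr_ge0 s; have p2 := normr_ge0 C1; have p3 := normr_ge0 C2.
pose A := `|s| + 20 * EX + 10 * EY + l + `|C1| + `|C2|.
exists (`|C2| + 2 * A + 2 * EX + 20 * EY) => g.
pose T := horo_product bX (aX g o) o.
have TE : T <= 2 * EX := focal_horo_le fX _.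
have Tb : T <= bX (aX g o) + EX := focal_le fX _ _.
(* A power of h that brings g just to the scale s at which continuity
   applies. *)
have [m m1 m2] : exists2 m : nat, `|s| + 14 * EX - T <= m%:R * l &
    m%:R * l <= `|s| + 14 * EX - T + l.
  have x0 : 0 <= (`|s| + 14 * EX - T) / l.
    by apply: divr_ge0; [lra|exact: ltW].
  have /andP[t1 t2] := truncn_itv x0.
  exists (Num.truncn ((`|s| + 14 * EX - T) / l)).+1.
    by apply: ltW; rewrite -ltr_pdivrMr.
  by rewrite -natr1 mulrDl mul1r lerD2r -ler_pdivlMr.
have [N hN] : gp_eventually o' (aY (h ^+ m * g)%g \o orbit_seq aY h o')
    (orbit_seq aY h o') (9 * EY + 1).
  apply: hs; exists m => i j _ mj; rewrite /= /orbit_seq.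
  apply: le_trans (focal_gp_ge fX _ _).
  rewrite -(subnKC mj) act_expD actM.
  have := focal_horo_act fX (h ^+ m)%g (aX g (aX (h ^+ i)%g o))
    (aX (h ^+ (j - m))%g o).
  have := focal_horo_orbit fX g i (j - m)%N; rewrite -/T.
  have := focal_fwd fX m; rewrite -/l.
  by rewrite !ler_norml => /andP[? ?] ? /andP[? ?]; lra.
have := hN N (m + N)%N (leqnn _) (leq_addl _ _); rewrite /= /orbit_seq.
move=> /(focal_gp_rev fY); rewrite act_expD actM => hY.
have {}hY : T - A <=
    horo_product bY (aY g (aY (h ^+ N)%g o')) (aY (h ^+ N)%g o').
  have := focal_horo_act fY (h ^+ m)%g (aY g (aY (h ^+ N)%g o'))
    (aY (h ^+ N)%g o').
  have := focal_fwd fY m; rewrite -same_lengths -/l /A.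
  by move: hY; rewrite !ler_norml => ? /andP[? ?] /andP[? ?]; lra.
have := focal_horo_orbit_rev fY hY.
have := hC1 g; have := hC2 g.
have := focal_displacement fX g; have := focal_displacement fY g.
rewrite -/T !ler_norml => /andP[? ?] /andP[? ?] ? ? hT.
have := hT ltac:(rewrite /A; lra) ltac:(rewrite /A; lra); lra.
Qed.

End FocalDomination.

(** * Equivariant maps between boundaries *)

Lemma nontrivial_third {R : realType} {X : metricType R} (xi eta : boundary X) :
  nontrivial X -> exists zeta, zeta <> xi /\ zeta <> eta.
Proof.
move=> /card_leP/unsquash f.
pose e n (n3 : (n < 3)%N) : `I_3 := exist _ n (mem_set n3).
pose F n n3 : boundary X := val (f (e n n3)).
have injF n m n3 m3 : F n n3 = F m m3 -> n = m.
  by move=> /val_inj/(inj (in_setT _) (in_setT _))/(congr1 val).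
apply: contrapT => hN.
have h n n3 : F n n3 = xi \/ F n n3 = eta.
  by apply: contrapT => /not_orP hF; apply: hN; exists (F n n3).
have {injF} ne n m n3 m3 z : F n n3 = z -> F m m3 = z -> n = m.
  by move=> nz mz; apply: (injF _ _ n3 m3); rewrite nz mz.
have [a|a] := h 0%N isT; have [b|b] := h 1%N isT; have [c|c] := h 2%N isT.
all: try by have := ne _ _ _ _ _ a b.
all: try by have := ne _ _ _ _ _ a c.
all: by have := ne _ _ _ _ _ b c.
Qed.

Section BoundaryMaps.
Context {R : realType} {G : groupType} {X Y : metricType R}.
Variables (aX : isometric_action G X) (aY : isometric_action G Y).

Definition shadow_continuous (o : X) (o' : Y) (F : boundary X -> boundary Y) :=
  forall xi r, exists s, forall zeta, shadow o xi s (AtInfinity zeta) ->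
    shadow o' (F xi) r (AtInfinity (F zeta)).

Definition boundary_equivariant (F : boundary X -> boundary Y) :=
  forall g xi, F (boundary_act aX g xi) = boundary_act aY g (F xi).

End BoundaryMaps.

Section ComparableActions.
Context {R : realType} {G : groupType}.

Lemma continuous_shadow {X Y : metricType R} (A : set (boundary X))
    (B : set (boundary Y)) (f : A -> B) {dY : R} (o : X) (o' : Y) x r :
  gromov_hyperbolic Y dY -> {for x, continuous f} ->
  exists s, forall y : A, shadow o (\val x) s (AtInfinity (\val y)) ->
    shadow o' (\val (f x)) r (AtInfinity (\val (f y))).
Proof.
move=> hypY fc.
have n1 : nbhs (\val (f x) : boundary Y)
    (@AtInfinity R Y @^-1` shadow o' (\val (f x)) r).
  apply: (@initial_continuous (boundary Y) (bordification Y) (@AtInfinity R Y)).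
  exact: nbhs_shadow.
have n2 : nbhs (f x)
    (set_val @^-1` (@AtInfinity R Y @^-1` shadow o' (\val (f x)) r)).
  exact: (@initial_continuous B (boundary Y) set_val).
have [_ [[V [W oW <-] <-] Vx VU]] := fc _ n2.
have [_ Wsh] := oW; have [s sW] := Wsh _ Vx o.
by exists s => y /sW Wy; exact: (VU y Wy).
Qed.

Lemma comparable_boundary_maps {X Y : metricType R}
    (aX : isometric_action G X) (aY : isometric_action G Y) {dX dY : R}
    (o : X) (o' : Y) :
  gromov_hyperbolic X dX -> gromov_hyperbolic Y dY ->
  limit_set aX = setT -> limit_set aY = setT -> comparable_actions aX aY ->
  exists F H, [/\ cancel F H, cancel H F, boundary_equivariant aX aY F,
    shadow_continuous o o' F & shadow_continuous o' o H].
Proof.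
move=> hypX hypY LX LY [f [h [fh hf fc hc feq]]].
have inX xi : xi \in limit_set aX by rewrite LX in_setT.
have inY xi : xi \in limit_set aY by rewrite LY in_setT.
pose sX xi : limit_set aX := exist _ xi (inX xi).
pose sY xi : limit_set aY := exist _ xi (inY xi).
have sXK x : sX (\val x) = x by exact: val_inj.
have sYK x : sY (\val x) = x by exact: val_inj.
exists (fun xi => \val (f (sX xi))), (fun xi => \val (h (sY xi))); split.
- by move=> xi; rewrite sYK fh.
- by move=> xi; rewrite sXK hf.
- by move=> g xi; exact: feq.
- move=> xi r; have [s hs] := continuous_shadow o o' r hypY (fc (sX xi)).
  by exists s => zeta; exact: (hs (sX zeta)).
- move=> xi r; have [s hs] := continuous_shadow o' o r hypX (hc (sY xi)).
  by exists s => zeta; exact: (hs (sY zeta)).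
Qed.

End ComparableActions.

Section FixedEnd.
Context {R : realType} {G : groupType} {X Y : metricType R}.
Variables (aX : isometric_action G X) (aY : isometric_action G Y).
Context {dX dY : R}.
Hypothesis hypX : gromov_hyperbolic X dX.
Hypothesis hypY : gromov_hyperbolic Y dY.
Variables (o : X) (o' : Y) (F : boundary X -> boundary Y).
Hypothesis F_inj : injective F.
Hypothesis F_equiv : boundary_equivariant aX aY F.
Hypothesis F_cont : shadow_continuous o o' F.

Lemma boundary_fixed_image g xi :
  boundary_fixed aX g xi -> boundary_fixed aY g (F xi).
Proof. by move=> gxi; rewrite /boundary_fixed /= -F_equiv gxi. Qed.

(** The fixed points of [h] correspond; that the attracting ones do is seen on
    any third point, whose images under the powers of [h] converge to the
    attracting point on both sides. *)
Lemma attracting_image h omega eta xi :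
  hyperbolic aX h -> hyperbolic aY h ->
  boundary_seqs omega (orbit_seq aX h^-1%g o) ->
  boundary_seqs eta (orbit_seq aX h o) -> xi <> omega -> xi <> eta ->
  boundary_seqs (F eta) (orbit_seq aY h o') /\
  boundary_seqs (F omega) (orbit_seq aY h^-1%g o').
Proof.
move=> hX hY omegah etah xi_omega xi_eta.
have hXV := hyperbolicV o hX; have hYV := hyperbolicV o' hY.
have omega_eta : omega <> eta.
  move=> E; rewrite -E in etah.
  have := boundary_asymptotic hypX etah omegah.
  exact: orbit_not_asymptotic.
have fixF k z xi' : hyperbolic aX k -> boundary_seqs xi' (orbit_seq aX k z) ->
    boundary_fixed aY k (F xi').
  by move=> hk kz; apply: boundary_fixed_image; exact: (orbit_fixed hypX hk kz).
have fe := fixF h o eta hX etah.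
have fo : boundary_fixed aY h (F omega).
  by have /(boundary_fixedV hypY) := fixF _ _ _ hXV omegah; rewrite invgK.
have distinct z : boundary_seqs (F omega) z -> boundary_seqs (F eta) z -> False.
  move=> z1 z2; apply: omega_eta; apply: F_inj.
  exact: (boundary_meet hypY z1 z2 (boundary_gromov z1)).
have [he|he] := fixed_orbit hypY o' hY fe;
  have [ho|ho] := fixed_orbit hypY o' hY fo => //.
- by case: (distinct _ ho he).
- exfalso; have [K [K0 _ hK]] := orbit_gromov_product hypY o' hY.
  pose D := K + 3 * dY + 1.
  have xio : ~ boundary_seqs xi (orbit_seq aX h^-1%g o).
    move=> xo; apply: xi_omega.
    exact: (boundary_meet hypX xo omegah (boundary_gromov xo)).
  have Fxio : ~ boundary_seqs (F xi) (orbit_seq aY h^-1%g o').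
    move=> xo; apply: xi_eta; apply: F_inj.
    exact: (boundary_meet hypY xo he (boundary_gromov xo)).
  have [s hs] := F_cont eta (D + 2 * dY).
  have [N1 h1] := north_south hypX hX etah xio s.
  have [N2 h2] := north_south hypY hY ho Fxio (D + 2 * dY).
  pose n := (N1 + N2)%N.
  have s1 := hs _ (h1 n (leq_addr _ _)); rewrite F_equiv in s1.
  have s2 := h2 n (leq_addl _ _).
  have [y hy] := boundary_inh (boundary_act aY (h ^+ n)%g (F xi)).
  have g1 := shadow_all hypY s1 he hy; have g2 := shadow_all hypY s2 ho hy.
  have [N hN] := gp_eventually_trans hypY g2 (gp_eventually_sym g1).
  have := hN N N (leqnn _) (leqnn _); have := hK N N.
  have := delta_ge0 hypY o'; rewrite /D; lra.
- by case: (distinct _ ho he).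
Qed.

(** Continuity at the attracting point of [h], tested on its translates. *)
Lemma gp_transfer h eta :
  boundary_seqs eta (orbit_seq aX h o) ->
  boundary_seqs (F eta) (orbit_seq aY h o') ->
  forall r, exists s, forall g,
    gp_eventually o (aX g \o orbit_seq aX h o) (orbit_seq aX h o) s ->
    gp_eventually o' (aY g \o orbit_seq aY h o') (orbit_seq aY h o') r.
Proof.
move=> eX eY r; have [s hs] := F_cont eta (r + 2 * dY).
exists s => g gs; apply: gp_eventually_sym.
have : shadow o eta s (AtInfinity (boundary_act aX g eta)).
  apply/shadow_boundaryP; exists (orbit_seq aX h o), (aX g \o orbit_seq aX h o).
  by split=> //; [exact: boundary_act_mem|exact: gp_eventually_sym].
move=> /hs; rewrite F_equiv => sh.
have := shadow_all hypY sh eY (boundary_act_mem aY g eY).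
by rewrite addrK.
Qed.

End FixedEnd.

(** * Comparison of orbits *)

Section FixedEndComparison.
Context {R : realType} {G : groupType} {X Y : metricType R}.
Variables (aX : isometric_action G X) (aY : isometric_action G Y).
Context {dX dY : R}.
Hypothesis hypX : gromov_hyperbolic X dX.
Hypothesis hypY : gromov_hyperbolic Y dY.

(** Replacing a hyperbolic element by its inverse makes the fixed point at
    infinity its repelling one; continuity of the boundary map and of its inverse
    give one bound each. *)
Lemma fixed_end_dominated (o : X) (o' : Y) F H omega :
  cancel F H -> cancel H F -> boundary_equivariant aX aY F ->
  shadow_continuous o o' F -> shadow_continuous o' o H ->
  (forall g, boundary_fixed aX g omega) ->
  (exists g, hyperbolic aX g) -> nontrivial X ->
  translation_length aX = translation_length aY ->
  orbits_dominated aX aY o o' /\ orbits_dominated aY aX o' o.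
Proof.
move=> FH HF Feq Fc Hc fx [g hg] ntX lXY.
have [h hX omegah] : exists2 h, hyperbolic aX h &
    boundary_seqs omega (orbit_seq aX h^-1%g o).
  have [gg|gg] := fixed_orbit hypX o hg (fx g); last by exists g.
  by exists g^-1%g; [exact: hyperbolicV|rewrite invgK].
have hY : hyperbolic aY h by rewrite /hyperbolic -lXY.
pose eta := boundary_of (orbit_gromov_seq hypX o hX).
have etah : boundary_seqs eta (orbit_seq aX h o).
  by split; exact: (orbit_gromov_seq hypX).
have [xi [xi1 xi2]] := nontrivial_third omega eta ntX.
have [etaY omegaY] := attracting_image hypX hypY (can_inj FH) Feq Fc hX hY
  omegah etah xi1 xi2.
have fY k : boundary_fixed aY k (F omega).
  by rewrite /boundary_fixed /= -Feq fx.
have Heq : boundary_equivariant aY aX H.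
  by move=> k z; rewrite -{1}[z]HF -Feq FH.
have [bX [EX fbX]] := focal_exists hypX hX fx omegah.
have [bY [EY fbY]] := focal_exists hypY hY fY omegaY.
split.
  apply: (focal_dominated fbY fbX (esym lXY) hY).
  apply: (gp_transfer hypX Heq Hc etaY); by rewrite FH.
exact: (focal_dominated fbX fbY lXY hX (gp_transfer hypY Feq Fc etah etaY)).
Qed.

(** Orbits are compared by translation lengths alone when both actions are
    non-elementary; a point at infinity that the whole group fixes on one side
    has such an image on the other, and the boundary map takes over. *)
Lemma orbits_comparable (o : X) (o' : Y) :
  nontrivial X -> nontrivial Y ->
  geometrically_dense aX -> geometrically_dense aY ->
  comparable_actions aX aY -> translation_length aX = translation_length aY ->
  exists C, forall g, `|mdist (aX g o) o - mdist (aY g o') o'| <= C.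
Proof.
move=> ntX ntY [cX LX] [cY LY] cXY lXY.
have [F [H [FH HF Feq Fc Hc]]] :=
  comparable_boundary_maps o o' hypX hypY LX LY cXY.
have Heq : boundary_equivariant aY aX H.
  by move=> k z; rewrite -{1}[z]HF -Feq FH.
suff [[C1 h1] [C2 h2]] : orbits_dominated aX aY o o' /\
    orbits_dominated aY aX o' o.
  exists (`|C1| + `|C2|) => g; have := h1 g; have := h2 g.
  have := ler_norm C1; have := ler_norm C2.
  have := normr_ge0 C1; have := normr_ge0 C2.
  by rewrite ler_norml => *; apply/andP; split; lra.
case: cX => [neX|[hX [omega [fx _]] _]]; last first.
  exact: (fixed_end_dominated FH HF Feq Fc Hc fx hX ntX lXY).
case: cY => [neY|[hY [omega [fy _]] _]].
  split; first exact: (non_elementary_dominated o o' hypX neX lXY).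
  exact: (non_elementary_dominated o' o hypY neY (esym lXY)).
have fx g : boundary_fixed aX g (H omega).
  by rewrite /boundary_fixed /= -Heq fy.
apply: (fixed_end_dominated FH HF Feq Fc Hc fx _ ntX lXY).
by have [g hg] := hY; exists g; rewrite /hyperbolic lXY.
Qed.

End FixedEndComparison.

Lemma geometrically_dense_hyperbolic {R : realType} {G : groupType}
    {X : metricType R} (a : isometric_action G X) :
  geometrically_dense a -> exists g, hyperbolic a g.
Proof. by case=> -[[g [h [hg _ _]]] _|[[g hg] _ _] _]; exists g. Qed.

Theorem theorem5 (R : realType) (G : groupType) (X Y : metricType R)
    (aX : isometric_action G X) (aY : isometric_action G Y)
    (X_nontrivial : nontrivial X) (Y_nontrivial : nontrivial Y)
    (X_complete : roughly_geodesically_complete X)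
    (Y_complete : roughly_geodesically_complete Y)
    (aX_dense : geometrically_dense aX) (aY_dense : geometrically_dense aY)
    (aXY_comparable : comparable_actions aX aY)
    (same_lengths : translation_length aX = translation_length aY) :
  exists (phi : X -> Y) (C : R),
    [/\ 0 < C, roughly_equivariant aX aY phi, rough_isometry C phi &
        forall p q : X, `|mdist (phi p) (phi q) - mdist p q| < C].
Proof.
have [KX [dX [KX0 _ [gX hypX] _ cX]]] := X_complete.
have [KY [dY [KY0 _ [gY hypY] _ cY]]] := Y_complete.
have point (Z : metricType R) : nontrivial Z -> exists z : Z, True.
  move=> /card_leP/unsquash f.
  pose xi : boundary Z := val (f (exist _ 0%N (mem_set isT))).
  by have [z _] := boundary_inh xi; exists (z 0%N).
have [x _] := point X X_nontrivial; have [y _] := point Y Y_nontrivial.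
have [C0 orb] := orbits_comparable hypX hypY x y X_nontrivial Y_nontrivial
  aX_dense aY_dense aXY_comparable same_lengths.
have [CX hullX] := orbit_hull hypX x cX (proj2 aX_dense)
  (geometrically_dense_hyperbolic aX_dense).
have [CY hullY] := orbit_hull hypY y cY (proj2 aY_dense)
  (geometrically_dense_hyperbolic aY_dense).
exact: (extend_orbit_map hypX hypY (ltW KX0) (ltW KY0) gX gY hullX hullY orb).
Qed.
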